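(* Assume there is a polynomial $q_0$ such that for every $t\ge1$ and every positive integer $M$ the generalized binary value principle $\mathrm{BVP}_{t,M}$ has a boolean IPS refutation over $\mathbb{Z}$ of size at most $q_0(t,\tau(M))$. Then there is a polynomial $q$ such that the following holds. Let $\mathcal F$ be a system of polynomial equations and $\mathcal H=\{H_j(\bar x)\ge0\}_{j\in J}$ a system of polynomial inequalities over $\mathbb{Z}$ written as circuits (where $\mathcal H$ contains $f\ge0$ and $-f\ge0$ for every equation $f=0$ of $\mathcal F$ and for every $x_i^2-x_i=0$, as well as $x_i\ge 0$ and $1-x_i\ge0$). Let $C(\bar x,\bar y)$ be a boolean CPS refutation over $\mathbb{Z}$ of $\mathcal F,\mathcal H$ such that $C(\bar x,\mathcal H)$ has size $s$ and syntactic length $t$. Then there is a boolean IPS refutation over $\mathbb{Z}$ of the system of equations $\mathrm{tr}(\mathcal H)$ of size at most $q(s,t)$.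
   Context: Circuits: DAGs with leaves variables/integers and fan-in-two $+,\times$ gates; size = number of nodes (each constant counts one). $\tau(M)$: minimal size of a circuit with constants only $0,\pm1$ computing $M$. Boolean IPS over $\mathbb{Z}$: a proof of $p$ from $\{f_j=0\}$ is a circuit $C(\bar x,\bar y,\bar z)$ over $\mathbb{Z}$ with $C(\bar x,\bar0,\bar0)=0$ and $C(\bar x,\bar f,x_1^2-x_1,\dots,x_n^2-x_n)=p$ formally; a refutation proves a nonzero integer. Boolean CPS: a refutation is a $\bar y$-conic circuit $C(\bar x,y_1,\dots,y_\ell)$ (every leaf that is a negative constant or an $x$-variable has all paths to the output passing through a squaring gate, i.e. a product gate with both inputs from one node) with $C(\bar x,H_1,\dots,H_\ell)=-1$ formally. $\mathrm{BVP}_{t,M}$: $\sum_{i=1}^t2^{i-1}x_i+M=0$. Syntactic length: $\ell(x_j)=2$; integer leaf $\alpha$: least $k\ge1$ with $-2^{k-1}\le\alpha<2^{k-1}$; $\ell(G+H)=\max+1$; $\ell(G\cdot H)=2\max+3$. Bit extraction: two's complement $\mathrm{val}(w_0,\dots,w_{k-1})=\sum_{i=0}^{k-2}2^iw_i-2^{k-1}w_{k-1}$; padding appends sign bits; $a\wedge b=ab$, $a\vee b=1-(1-a)(1-b)$, $a\oplus b=a+b-2ab$; ADD of $\bar y,\bar z$ padded to length $t$ with $y_t=y_{t-1},z_t=z_{t-1}$: $\mathrm{carry}_0=0$, $\mathrm{carry}_i=(y_{i-1}\wedge z_{i-1})\vee((y_{i-1}\vee z_{i-1})\wedge\mathrm{carry}_{i-1})$,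 entries $y_i\oplus z_i\oplus\mathrm{carry}_i$ ($0\le i\le t$); $\mathrm{ABS}(\bar x)=\mathrm{ADD}(\bar x,(s,\dots,s))\oplus(s,\dots,s)$, $s$ the sign bit; $\mathrm{PROD}^+(\bar a,\bar b)=\mathrm{ADD}(\bar s_{t-1},\mathrm{ADD}(\dots,\mathrm{ADD}(\bar s_1,\bar s_0)))$ with $\bar s_i$ of length $t+i$, $s_{i,j}=a_{j-i}\wedge b_i$ for $i\le j\le t-1+i$, $0$ for $j<i$; $\mathrm{PROD}(\bar y,\bar z)$: XOR each entry of $\mathrm{PROD}^+(\mathrm{ABS}\bar y,\mathrm{ABS}\bar z)$ with $s=y_{t-1}\oplus z_{t-1}$, then ADD the nonnegative integer $s$. $\mathrm{bit}(x_j)=(x_j,0)$; $\mathrm{bit}(\alpha)$ = $\ell(\alpha)$-bit two's complement of $\alpha$; $\mathrm{bit}(G+H)=\mathrm{ADD}(\mathrm{bit}G,\mathrm{bit}H)$; $\mathrm{bit}(G\cdot H)=\mathrm{PROD}(\mathrm{bit}G,\mathrm{bit}H)$ (shorter padded first; subcircuits shared). The translation $\mathrm{tr}(H_j\ge0)$ is the equation $\mathrm{bit}_{\ell(H_j)-1}(H_j)=0$ stating that the sign bit of $H_j$ is $0$, and $\mathrm{tr}(\mathcal H)=\{\mathrm{tr}(H_j\ge0)\}_{j\in J}$. *)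

(* Defs.v *)
From mathcomp Require Import all_boot all_order all_algebra.
From mathcomp.multinomials Require Import mpoly.
From Stdlib Require Import ClassicalEpsilon.

Set Implicit Arguments.
Unset Strict Implicit.
Unset Printing Implicit Defensive.

Import Order.TTheory GRing.Theory Num.Theory.
Local Open Scope ring_scope.

(** A DAG is given by its nodes in a topological order: node number [k] is the
    [k]-th element of the sequence, and [Add i j], [Mul i j] refer to the nodes
    number [i] and [j], which must precede them. *)

Inductive gate (V : Type) : Type :=
  | Var of V
  | Const of int
  | Add of nat & nat
  | Mul of nat & nat.
Arguments Const {V}.
Arguments Add {V}.
Arguments Mul {V}.

Definition gate_args (V : Type) (g : gate V) : seq nat :=
  match g with Add i j | Mul i j => [:: i; j] | _ => [::] end.

Fixpoint ordered_from (V : Type) (k : nat) (s : seq (gate V)) : bool :=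
  if s is g :: s' then
    all (fun i => i < k)%N (gate_args g) && ordered_from k.+1 s'
  else true.

Record circuit (V : Type) : Type := Circuit {
  nodes : seq (gate V);
  out : nat;
  circuitP : ordered_from 0 nodes && (out < size nodes)%N }.

Definition csize (V : Type) (C : circuit V) : nat := size (nodes C).

Definition gate_at (V : Type) (C : circuit V) (k : nat) : gate V :=
  nth (Const 0) (nodes C) k.

Section Fold.
Variables (V A : Type) (fvar : V -> A) (fconst : int -> A).
Variables (fadd fmul : A -> A -> A).

Definition gate_val (acc : seq A) (g : gate V) : A :=
  let a i := nth (fconst 0) acc i in
  match g with
  | Var v => fvar v
  | Const c => fconst c
  | Add i j => fadd (a i) (a j)
  | Mul i j => fmul (a i) (a j)
  end.

Definition node_vals (s : seq (gate V)) : seq A :=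
  foldl (fun acc g => rcons acc (gate_val acc g)) [::] s.

(* The value at the output node of the map defined by recursion on the DAG. *)
Definition cfold (C : circuit V) : A :=
  nth (fconst 0) (node_vals (nodes C)) (out C).

End Fold.

Definition ceval (R : comNzRingType) (V : Type) (v : V -> R) (C : circuit V)
    : R :=
  cfold v (fun c : int => c%:~R) +%R *%R C.

(* The polynomial computed by a circuit in the variables [x_1, .., x_n]. *)
Definition cpoly (n : nat) (C : circuit 'I_n) : {mpoly int[n]} :=
  ceval (fun i => 'X_i) C.

(** [ccomp C H] is the circuit [C(x, H)]: all leaves [y_j] of [C] are replaced by
    one copy of the circuit [H j]; circuits [H j] such that [y_j] is not a leaf
    of [C] do not occur in it. *)

Section Composition.
Variables (n m : nat) (C : circuit ('I_n + 'I_m)) (H : 'I_m -> circuit 'I_n).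

Definition is_y (j : 'I_m) (g : gate ('I_n + 'I_m)) : bool :=
  if g is Var (inr j') then j' == j else false.

Definition used : seq 'I_m := [seq j <- enum 'I_m | has (is_y j) (nodes C)].

Definition shift_gate (b : nat) (g : gate 'I_n) : gate 'I_n :=
  match g with
  | Add i j => Add (b + i)%N (b + j)%N
  | Mul i j => Mul (b + i)%N (b + j)%N
  | _ => g
  end.

Fixpoint place (b : nat) (js : seq 'I_m) : seq (gate 'I_n) :=
  if js is j :: js' then
    map (shift_gate b) (nodes (H j)) ++ place (b + csize (H j))%N js'
  else [::].

(* The number of nodes of [place 0 js]. *)
Definition place_size (js : seq 'I_m) : nat := sumn [seq csize (H j) | j <- js].

(* The position in [place 0 used] of the output of [H j]. *)
Definition place_out (j : 'I_m) : nat :=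
  (place_size (take (index j used) used) + out (H j))%N.

Definition top_node (g : gate ('I_n + 'I_m)) : bool :=
  if g is Var (inr _) then false else true.

(* The new position of node number [k] of [C]. *)
Definition redirect (k : nat) : nat :=
  if gate_at C k is Var (inr j) then place_out j
  else (place_size used + count top_node (take k (nodes C)))%N.

Definition redirect_gate (g : gate ('I_n + 'I_m)) : option (gate 'I_n) :=
  match g with
  | Var (inl i) => Some (Var i)
  | Var (inr _) => None
  | Const c => Some (Const c)
  | Add i j => Some (Add (redirect i) (redirect j))
  | Mul i j => Some (Mul (redirect i) (redirect j))
  end.

Definition ccomp_nodes : seq (gate 'I_n) :=
  place 0 used ++ pmap redirect_gate (nodes C).

Lemma ordered_from_cat (V : Type) k (s1 s2 : seq (gate V)) :
  ordered_from k (s1 ++ s2) =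
  ordered_from k s1 && ordered_from (k + size s1) s2.
Proof.
elim: s1 k => [|g s1 IH] k /=; first by rewrite addn0.
by rewrite IH addSnnS andbA.
Qed.

Lemma ordered_from_shift b k (s : seq (gate 'I_n)) :
  ordered_from k s -> ordered_from (b + k) (map (shift_gate b) s).
Proof.
elim: s k => [|g s IH] k //= /andP[gk /IH]; rewrite addnS => ->.
by case: g gk => //= i j; rewrite !ltn_add2l andbT => ->.
Qed.

Lemma place_ordered b js : ordered_from b (place b js).
Proof.
elim: js b => [|j js IH] b //=; rewrite ordered_from_cat size_map IH andbT.
by have /andP[/(ordered_from_shift b)] := circuitP (H j); rewrite addn0.
Qed.

Lemma size_place b js : size (place b js) = place_size js.
Proof.
by elim: js b => [|j js IH] b //=; rewrite size_cat size_map IH.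
Qed.

Lemma mem_used k j : gate_at C k = Var (inr j) -> j \in used.
Proof.
rewrite mem_filter mem_enum andbT /gate_at => e.
have [lt_k|ge_k] := ltnP k (size (nodes C)); last by rewrite nth_default in e.
by apply/(has_nthP (Const 0)); exists k; rewrite ?e /=.
Qed.

Lemma place_out_lt j : j \in used -> (place_out j < place_size used)%N.
Proof.
move=> uj; have iu : (index j used < size used)%N by rewrite index_mem.
have -> : place_size used =
    (place_size (take (index j used) used) +
      (csize (H j) + place_size (drop (index j used).+1 used)))%N.
  rewrite -{1}(cat_take_drop (index j used) used) (drop_nth j iu) nth_index //.
  by rewrite /place_size map_cat sumn_cat.
by rewrite ltn_add2l ltn_addr //; case/andP: (circuitP (H j)).
Qed.

Lemma redirect_lt s1 s2 k : nodes C = s1 ++ s2 -> (k < size s1)%N ->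
  (redirect k < place_size used + count top_node s1)%N.
Proof.
move=> def_C lt_k; have := @mem_used k; rewrite /redirect.
have /= lt_top : top_node (gate_at C k) ->
    (place_size used + count top_node (take k (nodes C)) <
     place_size used + count top_node s1)%N.
  rewrite ltn_add2l /gate_at def_C nth_cat lt_k takel_cat ?(ltnW lt_k) // => tk.
  have := count_cat top_node (take k s1) (drop k s1).
  rewrite cat_take_drop (drop_nth (Const 0) lt_k) /= tk => ->.
  by rewrite add1n addnS ltnS leq_addr.
case: gate_at lt_top => [[i|j]|c|i j|i j] /= lt_top mu; try exact: lt_top.
by rewrite ltn_addr // place_out_lt // mu.
Qed.

Lemma size_redirect s : size (pmap redirect_gate s) = count top_node s.
Proof. by elim: s => //= -[[i|j]|c|i j|i j] s /= ->. Qed.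

Lemma redirect_ordered s1 s2 : nodes C = s1 ++ s2 -> ordered_from (size s1) s2 ->
  ordered_from (place_size used + count top_node s1) (pmap redirect_gate s2).
Proof.
elim: s2 s1 => [|g s2 IH] s1 //= def_C /andP[g_ok s2_ok].
have := IH (rcons s1 g); rewrite cat_rcons size_rcons => /(_ def_C s2_ok).
rewrite -cats1 count_cat /= addn0.
case: g g_ok def_C => [[i|j]|c|i j|i j] /= g_ok def_C; rewrite ?addn0 ?addn1 ?addnS //.
all: case/and3P: g_ok => lt_i lt_j _ ->.
all: by rewrite !(redirect_lt def_C).
Qed.

Lemma ccompP : ordered_from 0 ccomp_nodes &&
  (redirect (out C) < size ccomp_nodes)%N.
Proof.
have /andP[C_ok out_ok] := circuitP C; apply/andP; split.
  rewrite ordered_from_cat place_ordered size_place add0n /=.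
  by have := @redirect_ordered [::] (nodes C) erefl C_ok; rewrite addn0.
rewrite size_cat size_place size_redirect.
by apply: (@redirect_lt (nodes C) [::]); rewrite ?cats0.
Qed.

Definition ccomp : circuit 'I_n := Circuit ccompP.

End Composition.

Definition constant_free (V : Type) (C : circuit V) : bool :=
  all (fun g => if g is Const c then c \in [:: 0; 1; -1] else true) (nodes C).

(* The circuits computing an integer are taken without variables. *)
Definition tau_attained (M : int) (k : nat) : Prop :=
  exists C : circuit void, [/\ constant_free C,
    ceval (fun v : void => match v with end : int) C = M & csize C = k].

Definition tau_attainedb (M : int) (k : nat) : bool :=
  if excluded_middle_informative (tau_attained M k) then true else false.

Lemma ordered_from_rcons (V : Type) k (s : seq (gate V)) g :
  ordered_from k (rcons s g) =
  ordered_from k s && all (fun i => i < k + size s)%N (gate_args g).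
Proof. by rewrite -cats1 ordered_from_cat /= andbT. Qed.

Lemma size_node_vals (V A : Type) (fv : V -> A) fc fa fm s :
  size (node_vals fv fc fa fm s) = size s.
Proof.
by elim/last_ind: s => // s g IH; rewrite /node_vals foldl_rcons !size_rcons -IH.
Qed.

Lemma tau_exists M : exists k, tau_attainedb M k.
Proof.
suff [k kP] : exists k, tau_attained M k.
  by exists k; rewrite /tau_attainedb; case: excluded_middle_informative.
have [e [r [-> e01]]] : exists e r, M = e *+ r.+1 /\ e \in [:: 0; 1; -1 : int].
  case: M => [[|r]|r]; first by exists 0, 0%N.
    by exists 1, r; rewrite -[RHS]mulr_natl mulr1 natz.
  by exists (-1), r; rewrite NegzE mulNrn -[in RHS]mulr_natl mulr1 natz.
pose s := iteri r (fun k s => rcons s (Add k 0)) [:: @Const void e].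
exists r.+1; have [s_sz s_ok s_cf [s_hd s_val]] : [/\ size s = r.+1,
    ordered_from 0 s,
    all (fun g => if g is Const c then c \in [:: 0; 1; -1] else true) s &
    let vs := node_vals (fun v : void => match v with end : int)
       (fun c : int => c%:~R) +%R *%R s in nth 0 vs 0 = e /\ nth 0 vs r = e *+ r.+1].
  rewrite {}/s; elim: r => [|r [s_sz s_ok s_cf [s_hd s_val]]] /=.
    by split; rewrite ?e01 //= intz.
  rewrite size_rcons ordered_from_rcons all_rcons s_sz s_ok s_cf /= ltnSn.
  split=> //; rewrite /node_vals foldl_rcons -/(node_vals _ _ _ _ _) /=.
  rewrite !nth_rcons size_node_vals s_sz /= ltnn eqxx s_hd; split=> //.
  by rewrite s_val [RHS]mulrSr.
have sP : ordered_from 0 s && (r < size s)%N by rewrite s_ok s_sz /=.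
by exists (Circuit sP).
Qed.

Definition tau (M : int) : nat := ex_minn (tau_exists M).

(* Variables of an IPS circuit: [x_i], a placeholder [y_j] for the axiom [f_j] and
   a placeholder [z_i] for the boolean axiom [x_i ^ 2 - x_i]. *)
Inductive ips_var (n m : nat) : Type :=
  | IpsX of 'I_n
  | IpsY of 'I_m
  | IpsZ of 'I_n.

Definition ips_subst (n m : nat) (f : 'I_m -> {mpoly int[n]})
    (b : 'I_n -> {mpoly int[n]}) (v : ips_var n m) : {mpoly int[n]} :=
  match v with
  | IpsX i => 'X_i
  | IpsY j => f j
  | IpsZ i => b i
  end.

Definition ips_proof (n m : nat) (f : 'I_m -> {mpoly int[n]})
    (p : {mpoly int[n]}) (C : circuit (ips_var n m)) : Prop :=
  ceval (ips_subst (fun _ => 0) (fun _ => 0)) C = 0 /\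
  ceval (ips_subst f (fun i => 'X_i ^+ 2 - 'X_i)) C = p.

Definition ips_refutation (n m : nat) (f : 'I_m -> {mpoly int[n]})
    (C : circuit (ips_var n m)) : Prop :=
  exists2 M : int, M != 0 & ips_proof f M%:MP C.

(* In [circuit ('I_n + 'I_m)], [inl i] is the variable [x_i] and [inr j] is the
   variable [y_j]. *)
Definition edge (V : Type) (C : circuit V) : rel nat :=
  fun i k => i \in gate_args (gate_at C k).

Definition squaring (V : Type) (C : circuit V) (k : nat) : bool :=
  if gate_at C k is Mul i j then i == j else false.

Definition guarded_leaf (n m : nat) (C : circuit ('I_n + 'I_m)) (k : nat)
    : bool :=
  match gate_at C k with
  | Var (inl _) => true
  | Const c => c < 0
  | _ => false
  end.

Definition conic (n m : nat) (C : circuit ('I_n + 'I_m)) : Prop :=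
  forall (k : nat) (p : seq nat), guarded_leaf C k ->
    path (edge C) k p -> last k p = out C -> has (squaring C) (k :: p).

(* The conditions on the circuits [H] are on the polynomials they compute. *)
Definition boolean_system (n m : nat) (F : seq {mpoly int[n]})
    (H : 'I_m -> circuit 'I_n) : Prop :=
  let has_ineq p := exists j, cpoly (H j) = p in
  [/\ forall f, f \in F -> has_ineq f /\ has_ineq (- f),
      forall i, has_ineq ('X_i ^+ 2 - 'X_i) /\ has_ineq (- ('X_i ^+ 2 - 'X_i))
    & forall i, has_ineq 'X_i /\ has_ineq (1 - 'X_i)].

Definition cps_refutation (n m : nat) (F : seq {mpoly int[n]})
    (H : 'I_m -> circuit 'I_n) (C : circuit ('I_n + 'I_m)) : Prop :=
  [/\ boolean_system F H, conic C & cpoly (ccomp C H) = -1].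

(* The index [i] starts at 0, whence the coefficients [2 ^ i]. *)
Definition bvp (t : nat) (M : int) : {mpoly int[t]} :=
  \sum_(i < t) 2 ^+ i *: 'X_i + M%:MP.

Definition fits (a : int) (k : nat) : bool :=
  (0 < k)%N && (- 2 ^+ k.-1 <= a < 2 ^+ k.-1).

Lemma fits_exists a : exists k, fits a k.
Proof.
exists `|a|%N.+1; rewrite /fits /=.
have lt_a : `|a| < 2 ^+ `|a|%N :> int.
  by rewrite -abszE -natrX -natz ltr_nat ltn_expl.
by move: lt_a; rewrite ltr_norml => /andP[/ltW -> ->].
Qed.

Definition int_len (a : int) : nat := ex_minn (fits_exists a).

Definition clen (n : nat) (C : circuit 'I_n) : nat :=
  cfold (fun _ => 2) int_len
    (fun a b => (maxn a b).+1) (fun a b => (2 * maxn a b + 3)%N) C.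

Section Bits.
Variable R : comNzRingType.
Implicit Types (a b : R) (w y z : seq R) (k t : nat).

Definition band a b : R := a * b.
Definition bor a b : R := 1 - (1 - a) * (1 - b).
Definition bxor a b : R := a + b - 2 * a * b.

Definition pad k w : seq R := w ++ nseq (k - size w) (last 0 w).

Fixpoint carry y z (i : nat) : R :=
  if i is i'.+1 then
    bor (band y`_i' z`_i') (band (bor y`_i' z`_i') (carry y z i'))
  else 0.

Definition ADD y z : seq R :=
  let t := maxn (size y) (size z) in
  let y' := pad t.+1 y in
  let z' := pad t.+1 z in
  mkseq (fun i => bxor (bxor y'`_i z'`_i) (carry y' z' i)) t.+1.

Definition xor_all (s : R) w : seq R := [seq bxor a s | a <- w].

Definition ABS w : seq R :=
  let s := last 0 w in xor_all s (ADD w (nseq (size w) s)).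

(* The two arguments are meant to have the same size. *)
Definition PRODp y z : seq R :=
  let t := size y in
  let s i := mkseq (fun j => if (j < i)%N then 0 else band y`_(j - i) z`_i)
                   (t + i) in
  foldl (fun acc i => ADD (s i) acc) (s 0) (iota 1 t.-1).

Definition PROD y z : seq R :=
  let t := maxn (size y) (size z) in
  let y' := pad t y in
  let z' := pad t z in
  let s := bxor y'`_t.-1 z'`_t.-1 in
  ADD (xor_all s (PRODp (ABS y') (ABS z'))) [:: s; 0].

(* The [int_len a] bits of [a] modulo [2 ^ int_len a]. *)
Definition int_bits (a : int) : seq R :=
  let k := int_len a in
  mkseq (fun i => (odd (`|(a %% 2 ^+ k)%Z| %/ 2 ^ i))%:R) k.

End Bits.

(* The polynomials computed by the bits of a circuit. *)
Definition cbit (n : nat) (C : circuit 'I_n) : seq {mpoly int[n]} :=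
  cfold (fun j => [:: 'X_j; 0]) (@int_bits _) (@ADD _) (@PROD _) C.

(* The left-hand side of the equation stating that the sign bit of [C] is 0. *)
Definition tr (n : nat) (C : circuit 'I_n) : {mpoly int[n]} :=
  (cbit C)`_(clen C).-1.

(* The value at [(a, b)] of a polynomial in two variables. *)
Definition eval2 (q : {mpoly int[2]}) (a b : nat) : int :=
  q.@[tnth [tuple a%:Z; b%:Z]].

(* Main.v *)
Require Import Defs.
From mathcomp Require Import all_boot all_order all_algebra.
From mathcomp.multinomials Require Import mpoly.
From mathcomp Require Import ring zify.
From Stdlib Require Import Classical.

Set Implicit Arguments.
Unset Strict Implicit.
Unset Printing Implicit Defensive.

Import Order.TTheory GRing.Theory Num.Theory.
Local Open Scope ring_scope.

(** The bits of every node of [C(x, H)] can be computed by a circuit of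
    polynomial size, and modulo the boolean axioms there are short proofs that
    they are boolean and that their two's complement value is the polynomial
    computed by the node: this follows from the full adder identity
    [o + 2 c' - y - z - c = 2 c (y ^ 2 - y) (z ^ 2 - z)].  Nodes longer than [t]
    are not below the output and are ignored.  Starting from the axioms
    [tr (H j)], one proves by induction along the conic circuit that the sign bit
    vanishes at all nodes that do not need a squaring on the way to the output;
    for a product this uses that both signs agree, which is automatic for a
    square.  At the output, whose polynomial is [-1], the bits [w_i] thus
    satisfy [2 ^ 0 w_0 + .. + 2 ^ (t - 1) w_(t - 1) + 1 = 0], and substituting them in
    the refutation of [BVP_(t, 1)] gives the result; only [M = 1] is needed. *)

(** * Straight-line programs for circuits and proofs *)

Lemma node_vals_rcons (V A : Type) (fv : V -> A) fc fa fm l g :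
  node_vals fv fc fa fm (rcons l g) =
  rcons (node_vals fv fc fa fm l)
        (gate_val fv fc fa fm (node_vals fv fc fa fm l) g).
Proof. by rewrite /node_vals foldl_rcons. Qed.

Section Programs.
Variables (R : comNzRingType) (V : Type) (ev1 ev2 : V -> R).
Implicit Types (s : seq (R * R)) (p q : R) (Q : seq (R * R) -> Prop).

(** A pair holds the values of one gate under the assignments [ev1] and [ev2]. Arguments are named
    by their pairs of values and not by positions, so no indices have to be tracked when a program
    grows. *)
Definition justified s (a : R * R) : Prop :=
  [\/ exists v, a = (ev1 v, ev2 v),
      exists c : int, a = (c%:~R, c%:~R),
      exists b c, [/\ b \in s, c \in s & a = (b.1 + c.1, b.2 + c.2)] |
      exists b c, [/\ b \in s, c \in s & a = (b.1 * c.1, b.2 * c.2)]].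

Inductive program : seq (R * R) -> Prop :=
  | program_nil : program [::]
  | program_rcons s a : program s -> justified s a -> program (rcons s a).

(** Positions are restored by [index]: the first node with the right pair of values serves as the
    argument. *)
Lemma program_nodes s : program s -> exists l : seq (gate V),
  [/\ size l = size s, ordered_from 0 l,
      node_vals ev1 (fun c : int => c%:~R) +%R *%R l = unzip1 s &
      node_vals ev2 (fun c : int => c%:~R) +%R *%R l = unzip2 s].
Proof.
elim=> [|{}s a _ [l [sz_l ord_l v1 v2]] js]; first by exists [::].
suff [g [lt_g g1 g2]] : exists g : gate V,
    [/\ all (fun i => i < size l)%N (gate_args g),
        gate_val ev1 (fun c : int => c%:~R) +%R *%R (unzip1 s) g = a.1 &
        gate_val ev2 (fun c : int => c%:~R) +%R *%R (unzip2 s) g = a.2].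
  exists (rcons l g); rewrite !size_rcons sz_l ordered_from_rcons ord_l add0n.
  by rewrite !node_vals_rcons v1 v2 g1 g2 /unzip1 /unzip2 !map_rcons.
have nth1 b : b \in s -> nth 0%:~R (unzip1 s) (index b s) = b.1.
  by move=> bs; rewrite (nth_map 0) ?index_mem // nth_index.
have nth2 b : b \in s -> nth 0%:~R (unzip2 s) (index b s) = b.2.
  by move=> bs; rewrite (nth_map 0) ?index_mem // nth_index.
case: js => [[v ->]|[c ->]|[b [c [bs cs ->]]]|[b [c [bs cs ->]]]].
- by exists (Var v).
- by exists (Const c).
- by exists (Add (index b s) (index c s)); rewrite /= !nth1 ?nth2 ?sz_l ?index_mem ?bs ?cs.
- by exists (Mul (index b s) (index c s)); rewrite /= !nth1 ?nth2 ?sz_l ?index_mem ?bs ?cs.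
Qed.

Lemma program_circuit s a : program s -> a \in s ->
  exists C : circuit V,
    [/\ csize C = size s, ceval ev1 C = a.1 & ceval ev2 C = a.2].
Proof.
move=> /program_nodes[l [sz_l ord_l v1 v2]] sa.
have lP : ordered_from 0 l && (index a s < size l)%N by rewrite ord_l sz_l index_mem.
exists (Circuit lP); split=> //; rewrite /ceval /cfold /= ?v1 ?v2.
  by rewrite (nth_map 0) ?index_mem // nth_index.
by rewrite (nth_map 0) ?index_mem // nth_index.
Qed.

(* The quantification over all programs containing [s] makes this monotone in [s]. *)
Definition reaches s (c : nat) Q : Prop :=
  forall s1, {subset s <= s1} -> program s1 ->
  exists s2, [/\ {subset s1 <= s2}, program s2, (size s2 <= size s1 + c)%N & Q s2].

(* An IPS circuit has a value at [(x, 0, 0)] and one at [(x, f, x ^ 2 - x)]: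
   [(p, p)] is a circuit for [p] and [(0, p)] is a proof of [p]. *)
Definition known s p : Prop := (p, p) \in s.
Definition proved s p : Prop := (0, p) \in s.

Lemma reaches_ret s c Q : (forall s', {subset s <= s'} -> Q s') -> reaches s c Q.
Proof. by move=> sQ s1 ss1 r1; exists s1; rewrite leq_addr; split=> //; apply: sQ. Qed.

Lemma reaches_bind s c c' Q Q' : reaches s c Q ->
  (forall s', {subset s <= s'} -> Q s' -> reaches s' c' Q') ->
  reaches s (c + c') Q'.
Proof.
move=> sQ QQ' s1 ss1 /(sQ _ ss1)[s2 [s12 r2 sz2 Q2]].
have ss2 : {subset s <= s2} by move=> x /ss1 /s12.
have [s3 [s23 r3 sz3 Q3]] := QQ' _ ss2 Q2 s2 (fun x h => h) r2.
exists s3; split=> //; first by move=> x /s12 /s23.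
by rewrite addnA (leq_trans sz3) // leq_add2r.
Qed.

Lemma reaches_weak s c c' Q Q' : reaches s c Q -> (c <= c')%N ->
  (forall s', {subset s <= s'} -> Q s' -> Q' s') -> reaches s c' Q'.
Proof.
move=> sQ le_c QQ' s1 ss1 /(sQ _ ss1)[s2 [s12 r2 sz2 Q2]]; exists s2; split=> //.
  by rewrite (leq_trans sz2) // leq_add2l.
by apply: QQ' => // x /ss1 /s12.
Qed.

Lemma reaches_sub s s' c Q : {subset s <= s'} -> reaches s c Q -> reaches s' c Q.
Proof. by move=> ss' sQ s1 s's1; apply: sQ => x /ss' /s's1. Qed.

(** Loop rule: [Q i] is the invariant after [i] rounds, each of which adds at most [c] nodes. *)
Lemma reaches_iter N c (Q : nat -> seq (R * R) -> Prop) s : Q 0%N s ->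
  (forall i s1 s2, {subset s1 <= s2} -> Q i s1 -> Q i s2) ->
  (forall i s', (i < N)%N -> {subset s <= s'} -> Q i s' -> reaches s' c (Q i.+1)) ->
  reaches s (N * c) (Q N).
Proof.
move=> Q0 Qmono; elim: N => [|N IH] QS.
  by apply: reaches_ret => s' ss'; apply: Qmono ss' Q0.
rewrite mulSnr; apply: reaches_bind (IH _) _; first by move=> i s' /ltnW; apply: QS.
by move=> s' ss'; apply: QS.
Qed.

Definition computes s c p := reaches s c (known^~ p).
Definition proves s c p := reaches s c (proved^~ p).

Lemma computes_le s c c' p : computes s c p -> (c <= c')%N -> computes s c' p.
Proof. by move=> sp le_c; apply: reaches_weak sp le_c _. Qed.

Lemma proves_le s c c' p q : p = q -> proves s c q -> (c <= c')%N -> proves s c' p.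
Proof. by move=> -> sp le_c; apply: reaches_weak sp le_c _. Qed.

Lemma reaches_gate s a : justified s a -> reaches s 1 (fun s' => a \in s').
Proof.
move=> js s1 ss1 r1; exists (rcons s1 a); split.
- by move=> x xs1; rewrite mem_rcons inE xs1 orbT.
- apply: program_rcons r1 _.
  case: js => [h|h|[b [c [/ss1 bs /ss1 cs h]]]|[b [c [/ss1 bs /ss1 cs h]]]].
  + exact: Or41.
  + exact: Or42.
  + by apply: Or43; exists b, c.
  + by apply: Or44; exists b, c.
- by rewrite size_rcons addn1.
- by rewrite mem_rcons inE eqxx.
Qed.

Lemma computes_in s p : known s p -> computes s 0 p.
Proof. by move=> sp; apply: reaches_ret => s'; apply. Qed.

Lemma proves_in s p : proved s p -> proves s 0 p.
Proof. by move=> sp; apply: reaches_ret => s'; apply. Qed.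

Lemma reaches_op2 s a b ca cb x : reaches s ca (fun s' => a \in s') ->
  reaches s cb (fun s' => b \in s') ->
  (forall s', a \in s' -> b \in s' -> justified s' x) ->
  reaches s (ca + cb + 1) (fun s' => x \in s').
Proof.
move=> sa sb J; rewrite -addnA; apply: reaches_bind sa _ => s1 ss1 as1.
apply: reaches_bind (reaches_sub ss1 sb) _ => s2 s12 bs2.
by apply: reaches_gate; apply: J => //; apply: s12.
Qed.

Lemma computes_add s a b p q :
  computes s a p -> computes s b q -> computes s (a + b + 1) (p + q).
Proof.
move=> sp sq; apply: reaches_op2 sp sq _ => s' p_s q_s.
by apply: Or43; exists (p, p), (q, q).
Qed.

Lemma computes_mul s a b p q :
  computes s a p -> computes s b q -> computes s (a + b + 1) (p * q).
Proof.
move=> sp sq; apply: reaches_op2 sp sq _ => s' p_s q_s.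
by apply: Or44; exists (p, p), (q, q).
Qed.

Lemma proves_add s a b p q :
  proves s a p -> proves s b q -> proves s (a + b + 1) (p + q).
Proof.
move=> sp sq; apply: reaches_op2 sp sq _ => s' p_s q_s.
by apply: Or43; exists (0, p), (0, q); rewrite /= addr0.
Qed.

(** At the first assignment a proof has value 0, and so has every multiple of it: proved polynomials
    behave like an ideal over the computed ones. *)
Lemma proves_mul s a b p q :
  computes s a p -> proves s b q -> proves s (a + b + 1) (p * q).
Proof.
move=> sp sq; apply: reaches_op2 sp sq _ => s' p_s q_s.
by apply: Or44; exists (p, p), (0, q); rewrite /= mulr0.
Qed.

Lemma computes_int s (c : int) : computes s 1 c%:~R.
Proof. by apply: reaches_gate; apply: Or42; exists c. Qed.

Lemma computes_nat s (c : nat) : computes s 1 c%:R.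
Proof. exact: (@computes_int s c). Qed.

Lemma computes_pow2 s i : computes s 1 (2 ^+ i).
Proof. by rewrite -natrX; apply: computes_nat. Qed.

Lemma computes_opp s a p : computes s a p -> computes s (1 + a + 1) (- p).
Proof.
rewrite -mulN1r; apply: computes_mul; rewrite -[-1]/(- 1%:~R) -mulrNz.
exact: computes_int.
Qed.

Lemma computes_sqr s a p : computes s a p -> computes s (a + a + 1) (p ^+ 2).
Proof. by move=> sp; apply: computes_mul. Qed.

Lemma proves_opp s a p : proves s a p -> proves s (1 + a + 1) (- p).
Proof.
rewrite -mulN1r; apply: proves_mul; rewrite -[-1]/(- 1%:~R) -mulrNz.
exact: computes_int.
Qed.

(** The constant gate 0 is the pair [(0, 0)], at once a circuit for 0 and a proof of it. *)
Lemma proves0 s : proves s 1 0.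
Proof. exact: (@computes_nat s 0). Qed.

Lemma reaches_and s c c' Q Q' :
  (forall s1 s2, {subset s1 <= s2} -> Q s1 -> Q s2) ->
  reaches s c Q -> reaches s c' Q' -> reaches s (c + c') (fun s' => Q s' /\ Q' s').
Proof.
move=> Qm sQ sQ'; apply: reaches_bind sQ _ => s1 ss1 Q1.
by apply: reaches_weak (reaches_sub ss1 sQ') _ _ => // s2 s12 Q2; split=> //; apply: Qm Q1.
Qed.

(** The gates of [B] are copied one by one onto the program, with pairs already present in place of
    its variables. With proofs in place of the axioms this substitutes into an IPS refutation. *)
Lemma reaches_circuit (W : Type) (u1 u2 : W -> R) (B : circuit W) s :
  (forall w, (u1 w, u2 w) \in s) ->
  reaches s (csize B) (fun s' => (ceval u1 B, ceval u2 B) \in s').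
Proof.
move=> su; rewrite /ceval /cfold /csize; case: B => l o /= /andP[ord_l lt_o].
suff /reaches_weak H : reaches s (size l) (fun s' => forall i, (i < size l)%N ->
    (nth 0%:~R (node_vals u1 (fun c : int => c%:~R) +%R *%R l) i,
     nth 0%:~R (node_vals u2 (fun c : int => c%:~R) +%R *%R l) i) \in s').
  by apply: H => // s' _; apply.
elim/last_ind: l ord_l {o lt_o} => [|l g IH]; first by move=> _; apply: reaches_ret.
rewrite ordered_from_rcons => /andP[/IH {}IH lt_g].
rewrite size_rcons -addn1; apply: reaches_bind IH _ => s1 ss1 Hl.
rewrite !node_vals_rcons.
set v1 := node_vals u1 _ _ _ _ in Hl *; set v2 := node_vals u2 _ _ _ _ in Hl *.
have /reaches_weak Hg : reaches s1 1 (fun s' =>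
    (gate_val u1 (fun c : int => c%:~R) +%R *%R v1 g,
     gate_val u2 (fun c : int => c%:~R) +%R *%R v2 g) \in s').
  case: g lt_g => [w|c|i j|i j] /= lt_g.
  - by apply: reaches_ret => s' s1s'; apply/s1s'/ss1/su.
  - exact: computes_int.
  - have /and3P[/Hl hi /Hl hj _] := lt_g; apply: reaches_gate; apply: Or43.
    by do 2!eexists; split; [exact: hi | exact: hj | ].
  - have /and3P[/Hl hi /Hl hj _] := lt_g; apply: reaches_gate; apply: Or44.
    by do 2!eexists; split; [exact: hi | exact: hj | ].
apply: Hg => // s2 s12 g_s2 i.
rewrite addn1 ltnS leq_eqVlt !nth_rcons !size_node_vals => /predU1P[->|lt_i].
  by rewrite ltnn eqxx.
by rewrite lt_i; apply/s12/Hl.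
Qed.

End Programs.

(** * Boolean gates *)

Ltac compute_poly :=
  repeat first
    [ apply: computes_in; assumption
    | match goal with
      | |- computes _ _ _ _ (_ + _) => eapply computes_add
      | |- computes _ _ _ _ (- _) => eapply computes_opp
      | |- computes _ _ _ _ (_ * _) => eapply computes_mul
      | |- computes _ _ _ _ (_ ^+ 2) => eapply computes_sqr
      | |- computes _ _ _ _ (2 ^+ _) => apply: computes_pow2
      | |- computes _ _ _ _ _%:R => apply: computes_nat
      | |- computes _ _ _ _ 0 => apply: (@computes_nat _ _ _ _ _ 0)
      | |- computes _ _ _ _ 1 => apply: (@computes_nat _ _ _ _ _ 1)
      end ].

Ltac prove_poly :=
  repeat first
    [ apply: proves_in; assumption
    | match goal with
      | |- proves _ _ _ _ (_ + _) => eapply proves_add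
      | |- proves _ _ _ _ (- _) => eapply proves_opp
      | |- proves _ _ _ _ (_ * _) => eapply proves_mul; [compute_poly | ]
      | |- proves _ _ _ _ 0 => apply: proves0
      end ].

Ltac computes_by := eapply computes_le; [compute_poly | done].
(** The identity [e] is a certificate: it writes the goal as a combination of proved polynomials
    with computed coefficients. The cost is an existential variable fixed by the shape of the
    right-hand side and is compared with the stated bound by evaluation. *)
Ltac proves_by e :=
  eapply proves_le; [exact: e | prove_poly | done].

Section Bool.
Variables (R : comNzRingType) (V : Type) (ev1 ev2 : V -> R).
Implicit Types (s : seq (R * R)) (a b c p q y z : R) (w : seq R).
Local Notation reaches := (reaches ev1 ev2).
Local Notation computes := (computes ev1 ev2).
Local Notation proves := (proves ev1 ev2).

Definition boolean s a : Prop := known s a /\ proved s (a ^+ 2 - a).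

Lemma boolean_sub s s' a : {subset s <= s'} -> boolean s a -> boolean s' a.
Proof. by move=> ss' [/ss' ? /ss' ?]. Qed.

Lemma boolean_intro s (c c' : nat) a :
  computes s c a -> proves s c' (a ^+ 2 - a) -> reaches s (c + c') (boolean^~ a).
Proof. by apply: reaches_and => s1 s2; apply. Qed.

Lemma boolean_band s a b : boolean s a -> boolean s b ->
  reaches s 20 (boolean^~ (band a b)).
Proof.
move=> [ka pa] [kb pb]; rewrite /band.
apply: (@boolean_intro _ 1 19); first by computes_by.
have e : (a * b) ^+ 2 - a * b = b ^+ 2 * (a ^+ 2 - a) + a * (b ^+ 2 - b) by ring.
by proves_by e.
Qed.

Lemma boolean_bxor s a b : boolean s a -> boolean s b ->
  reaches s 50 (boolean^~ (bxor a b)).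
Proof.
move=> [ka pa] [kb pb]; rewrite /bxor.
apply: (@boolean_intro _ 20 30); first by computes_by.
have e : (a + b - 2 * a * b) ^+ 2 - (a + b - 2 * a * b) =
     (1 - 2 * b) ^+ 2 * (a ^+ 2 - a) + (b ^+ 2 - b) by ring.
by proves_by e.
Qed.

Lemma boolean_bor s a b : boolean s a -> boolean s b ->
  reaches s 50 (boolean^~ (bor a b)).
Proof.
move=> [ka pa] [kb pb]; rewrite /bor.
apply: (@boolean_intro _ 20 30); first by computes_by.
have e : (1 - (1 - a) * (1 - b)) ^+ 2 - (1 - (1 - a) * (1 - b)) =
     (1 - b) ^+ 2 * (a ^+ 2 - a) + (1 - a) * (b ^+ 2 - b) by ring.
by proves_by e.
Qed.

(** One step of the recursion of [carry]; on bits it is the majority of the three. *)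
Definition maj y z c := bor (band y z) (band (bor y z) c).

Lemma boolean_maj s y z c : boolean s y -> boolean s z -> boolean s c ->
  reaches s 200 (boolean^~ (maj y z c)).
Proof.
move=> by_ bz bc; rewrite -[200%N]/(20 + (50 + (20 + 110)))%N.
apply: reaches_bind (boolean_band by_ bz) _ => s1 ss1 b1.
apply: reaches_bind (reaches_sub ss1 (boolean_bor by_ bz)) _ => s2 s12 b2.
have {}bc := boolean_sub s12 (boolean_sub ss1 bc).
apply: reaches_bind (boolean_band b2 bc) _ => s3 s23 b3.
have /boolean_bor H := boolean_sub s23 (boolean_sub s12 b1).
by apply: reaches_weak (H _ b3) _ _.
Qed.

Definition bsum y z c := bxor (bxor y z) c.

Lemma boolean_bsum s y z c : boolean s y -> boolean s z -> boolean s c ->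
  reaches s 100 (boolean^~ (bsum y z c)).
Proof.
move=> by_ bz bc; rewrite -[100%N]/(50 + 50)%N.
apply: reaches_bind (boolean_bxor by_ bz) _ => s1 ss1 b1.
by apply: boolean_bxor b1 _; apply: boolean_sub bc.
Qed.

Lemma proves_full_adder s y z c : boolean s y -> boolean s z -> boolean s c ->
  proves s 50 (bsum y z c - (y + z) - c + 2 * maj y z c).
Proof.
move=> [ky py] [kz pz] [kc pc].
have e : bsum y z c - (y + z) - c + 2 * maj y z c =
    2 * c * (z ^+ 2 - z) * (y ^+ 2 - y).
  by rewrite /bsum /maj /bxor /bor /band; ring.
by proves_by e.
Qed.

(* At the position of the repeated sign bits, [maj y z c] is the last carry. *)
Lemma proves_sign_adder s y z c : boolean s y -> boolean s z -> boolean s c ->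
  proves s 100 (bsum y z (maj y z c) - (y + z - maj y z c)).
Proof.
move=> [ky py] [kz pz] [kc pc].
have e : bsum y z (maj y z c) - (y + z - maj y z c) =
    2 * (z ^+ 2 - c * (1 - 2 * z) ^+ 2 +
         (1 - (y + z - 2 * y * z)) * c * (z ^+ 2 - z)) * (y ^+ 2 - y) +
    2 * (y ^+ 2 - c) * (z ^+ 2 - z).
  by rewrite /bsum /maj /bxor /bor /band; ring.
by proves_by e.
Qed.

(** The majority of 0, 0 and any carry is 0, so adding two numbers with sign bit 0 gives sign bit 0
    again. *)
Lemma proves_sign_adder0 s y z c : known s y -> known s z -> known s c ->
  proved s y -> proved s z -> proves s 200 (bsum y z (maj y z c)).
Proof.
move=> ky kz kc py pz.
(* The majority is [y * A + z * B] with [A = z + (1 - y * z) * (1 - z) * c] and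
   [B = (1 - y * z) * c]; the other factors come from expanding the two exclusive ors. *)
have e : bsum y z (maj y z c) =
    ((1 - 2 * z) * (1 - 2 * (y * (z + (1 - y * z) * (1 - z) * c) + z * ((1 - y * z) * c)))
       + (z + (1 - y * z) * (1 - z) * c)) * y +
    (1 - 2 * (y * (z + (1 - y * z) * (1 - z) * c) + z * ((1 - y * z) * c))
       + (1 - y * z) * c) * z.
  by rewrite /bsum /maj /bxor /bor /band; ring.
by proves_by e.
Qed.
End Bool.

(** * Addition and absolute value in two's complement *)

Section TwosComplement.
Variable R : comNzRingType.
Implicit Types (w y z : seq R).

(** The top bit gets the weight [2 ^ N - 2 ^ N.+1 = - 2 ^ N], as in two's complement. In this form
    the value is the plain binary sum as soon as the last bit is 0. *)
Definition tcval w : R := \sum_(i < size w) 2 ^+ i * w`_i - 2 ^+ size w * last 0 w.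

Lemma tcvalE w N : size w = N.+1 ->
  tcval w = \sum_(i < N) 2 ^+ i * w`_i - 2 ^+ N * w`_N.
Proof.
by move=> sz_w; rewrite /tcval -nth_last sz_w big_ord_recr /= exprS; ring.
Qed.

Lemma size_pad k w : (size w <= k)%N -> size (pad k w) = k.
Proof. by move=> le_k; rewrite size_cat size_nseq subnKC. Qed.

Lemma nth_pad k w i : (i < k)%N ->
  (pad k w)`_i = if (i < size w)%N then w`_i else last 0 w.
Proof.
move=> lt_i; rewrite nth_cat nth_nseq; case: ltnP => // le_i.
by rewrite ltn_sub2rE ?lt_i.
Qed.

Lemma last_pad k w : last 0 (pad k w) = last 0 w.
Proof. by rewrite last_cat; elim: (k - size w)%N => //= j; case: j. Qed.

(** Sign extension: one more copy of the sign bit [b] in position [k] adds [2 ^ k * b] to the sum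
    and as much to the subtracted term. *)
Lemma tcval_pad k w : (0 < size w <= k)%N -> tcval (pad k w) = tcval w.
Proof.
case/andP=> w0 /subnKC <-; elim: (k - size w)%N => [|d IH].
  by rewrite /pad addn0 subnn cats0.
have e : pad (size w + d.+1) w = rcons (pad (size w + d) w) (last 0 w).
  by rewrite /pad !addKn -[d.+1]addn1 nseqD catA cats1.
rewrite -IH e; set v := pad _ w.
have sz_v : size v = (size w + d)%N by rewrite size_pad ?leq_addr.
have lv : last 0 v = last 0 w by exact: last_pad.
rewrite /tcval size_rcons last_rcons big_ord_recr /= nth_rcons ltnn eqxx exprS lv.
have -> : \sum_(i < size v) 2 ^+ i * (rcons v (last 0 w))`_i =
          \sum_(i < size v) 2 ^+ i * v`_i.
  by apply: eq_bigr => i _; rewrite nth_rcons ltn_ord.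
by ring.
Qed.

Lemma size_ADD y z : size (ADD y z) = (maxn (size y) (size z)).+1.
Proof. by rewrite size_mkseq. Qed.

Lemma last_mkseq (f : nat -> R) N : last 0 (mkseq f N.+1) = f N.
Proof. by rewrite -nth_last size_mkseq nth_mkseq. Qed.

Lemma tcval_mkseq (f : nat -> R) N :
  tcval (mkseq f N.+1) = \sum_(i < N) 2 ^+ i * f i - 2 ^+ N * f N.
Proof.
rewrite (@tcvalE _ N) ?size_mkseq // nth_mkseq //; congr (_ - _).
by apply: eq_bigr => i _; rewrite nth_mkseq // ltnS ltnW.
Qed.

(** Each bit [a] becomes [(1 - 2 * b) * a + b], and a constant string of [b] has value [- b]. For
    [b = 1] this is the complement [- v - 1]. *)
Lemma tcval_xor_all (b : R) w : (0 < size w)%N ->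
  tcval (xor_all b w) = (1 - 2 * b) * tcval w - b.
Proof.
case: w => // a w _.
rewrite !(@tcvalE _ (size w)) ?size_map //= -/(xor_all b (a :: w)).
have xE i : (i <= size w)%N -> (xor_all b (a :: w))`_i = (1 - 2 * b) * (a :: w)`_i + b.
  by move=> le_i; rewrite (nth_map 0) //= /bxor; ring.
rewrite xE // (eq_bigr (fun i : 'I__ => (1 - 2 * b) * (2 ^+ i * (a :: w)`_i) + 2 ^+ i * b));
  last by move=> i _; rewrite xE 1?ltnW //; ring.
rewrite big_split /= -mulr_sumr -mulr_suml.
have -> : \sum_(i < size w) 2 ^+ i = 2 ^+ size w - 1 :> R.
  elim: (size w) => [|N IH]; first by rewrite big_ord0 expr0 subrr.
  by rewrite big_ord_recr /= IH exprS; ring.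
by ring.
Qed.

Lemma last_xor_all (b : R) w : (0 < size w)%N ->
  last 0 (xor_all b w) = bxor (last 0 w) b.
Proof. by case: w => // a w _; apply: (last_map (fun x => bxor x b)). Qed.

Lemma tcval_nseq (b : R) k : (0 < k)%N -> tcval (nseq k b) = - b.
Proof.
case: k => // k _; have -> : nseq k.+1 b = pad k.+1 [:: b] by rewrite /pad /= subn1.
by rewrite tcval_pad // (@tcvalE _ 0) // big_ord0 /=; ring.
Qed.

Lemma last_nseq (b : R) k : (0 < k)%N -> last 0 (nseq k b) = b.
Proof. by case: k => // k _; rewrite -nth_last nth_nseq size_nseq ltnSn. Qed.

End TwosComplement.

Section Arithmetic.
Variables (R : comNzRingType) (V : Type) (ev1 ev2 : V -> R).
Implicit Types (s : seq (R * R)) (a b c p q g : R) (w y z : seq R).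
Local Notation reaches := (reaches ev1 ev2).
Local Notation computes := (computes ev1 ev2).
Local Notation proves := (proves ev1 ev2).

Definition represents s w p : Prop :=
  [/\ (0 < size w)%N, forall i, (i < size w)%N -> boolean s w`_i,
      known s p & proved s (tcval w - p)].

Lemma represents_sub s s' w p :
  {subset s <= s'} -> represents s w p -> represents s' w p.
Proof.
by move=> ss' [w0 bw kp pp]; split=> // [i /bw||]; [apply: boolean_sub|apply: ss'|apply: ss'].
Qed.

Lemma represents_last s w p : represents s w p -> boolean s (last 0 w).
Proof. by case=> w0 bw _ _; rewrite -nth_last; apply: bw; rewrite prednK. Qed.

Lemma represents_pad s w p k : (size w <= k)%N -> represents s w p ->
  represents s (pad k w) p.
Proof.
move=> le_k rw; have [w0 bw kp pp] := rw; split=> //.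
- by rewrite size_pad // (leq_trans w0).
- move=> i; rewrite size_pad // => lt_i; rewrite nth_pad //.
  by case: ifP => [/bw|_] //; apply: represents_last rw.
- by rewrite tcval_pad ?w0.
Qed.

(** The full adder identities with weights [2 ^ i] telescope to the invariant [S i]. The formula for
    the sign bit is exported because proofs about signs start from it. *)
Lemma reaches_ADD s y z p q : represents s y p -> represents s z q ->
  reaches s (500 * (maxn (size y) (size z)).+1) (fun s' =>
    represents s' (ADD y z) (p + q) /\
    exists2 c, known s' c &
      last 0 (ADD y z) = bsum (last 0 y) (last 0 z) (maj (last 0 y) (last 0 z) c)).
Proof.
move=> ry rz; set t := maxn _ _.
have t0 : (0 < t)%N by rewrite leq_max; case: ry => ->.
have le_y : (size y <= t)%N by rewrite leq_maxl.
have le_z : (size z <= t)%N by rewrite leq_maxr.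
pose y' := pad t.+1 y; pose z' := pad t.+1 z.
have [_ by_ kp pp] : represents s y' p by apply: represents_pad; rewrite // leqW.
have [_ bz kq pq] : represents s z' q by apply: represents_pad; rewrite // leqW.
have sz_y : size y' = t.+1 by rewrite size_pad // leqW.
have sz_z : size z' = t.+1 by rewrite size_pad // leqW.
pose c := carry y' z'; pose o i := bsum y'`_i z'`_i (c i).
have ly : y'`_t = last 0 y by rewrite nth_pad // ltnNge le_y.
have lz : z'`_t = last 0 z by rewrite nth_pad // ltnNge le_z.
(* The padding reaches one position past the longer argument, so positions [t.-1] and [t] both hold
   the sign bits, and the last carry is their majority with the carry before. *)
have lc : c t = maj y'`_t z'`_t (c t.-1).
  rewrite -{1}(prednK t0) /= -/(maj _ _ _) -/c ly lz; congr maj.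
    rewrite nth_pad ?prednK //; case: ltnP => // lt_t.
    by rewrite -nth_last; have -> : t.-1 = (size y).-1 by lia.
  rewrite nth_pad ?prednK //; case: ltnP => // lt_t.
  by rewrite -nth_last; have -> : t.-1 = (size z).-1 by lia.
pose S i := \sum_(j < i) 2 ^+ j * o j - \sum_(j < i) 2 ^+ j * (y'`_j + z'`_j) + 2 ^+ i * c i.
have eADD : ADD y z = mkseq o t.+1 by [].
pose Q i s' := [/\ forall j, (j < i)%N -> boolean s' (o j),
  forall j, (j <= i)%N -> boolean s' (c j) & proved s' (S i)].
have Qsub i s1 s2 : {subset s1 <= s2} -> Q i s1 -> Q i s2.
  move=> s12 [bo bc pS]; split=> [j /bo|j /bc|]; try exact: boolean_sub.
  exact: s12.
(* The first carry, its boolean axiom and [S 0] are all 0, so one constant gate gives them. *)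
have Q0 : reaches s 1 (Q 0%N).
  have /reaches_weak H := @proves0 _ _ ev1 ev2 s; apply: H => // s1 _ p0.
  split=> // [[|j] // _|].
    by split=> //; rewrite expr0n subr0.
  by rewrite /S !big_ord0 subr0 add0r mulr0.
have Qstep i s' : (i < t)%N -> {subset s <= s'} -> Q i s' -> reaches s' 400 (Q i.+1).
  move=> lt_i ss' [bo bc pS].
  have {}by_ : boolean s' y'`_i by apply: boolean_sub ss' (by_ _ _); rewrite sz_y leqW.
  have {}bz : boolean s' z'`_i by apply: boolean_sub ss' (bz _ _); rewrite sz_z leqW.
  have bci := bc i (leqnn i); rewrite -[400%N]/(200 + (100 + (50 + 50)))%N.
  apply: reaches_bind (boolean_maj by_ bz bci) _ => s1 s1s bc1.
  apply: reaches_bind (reaches_sub s1s (boolean_bsum by_ bz bci)) _ => s2 s12 bo1.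
  have s2s : {subset s' <= s2} by move=> x /s1s /s12.
  apply: reaches_bind (reaches_sub s2s (proves_full_adder by_ bz bci)) _.
  move=> s3 s23 pr; have s3s : {subset s' <= s3} by move=> x /s2s /s23.
  have {}pS := s3s _ pS.
  have e : S i.+1 = S i +
      2 ^+ i * (o i - (y'`_i + z'`_i) - c i + 2 * maj y'`_i z'`_i (c i)).
    have ec : c i.+1 = maj y'`_i z'`_i (c i) by [].
    by rewrite /S !big_ord_recr /= exprS ec; ring.
  have /reaches_weak H : proves s3 50 (S i.+1) by proves_by e.
  apply: H => // s4 s34 {}pS.
  have s4s : {subset s' <= s4} by move=> x /s3s /s34.
  have s24 : {subset s2 <= s4} by move=> x /s23 /s34.
  split=> // j; rewrite ?ltnS leq_eqVlt => /predU1P[->|lt_j].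
  - exact: boolean_sub s24 bo1.
  - exact: boolean_sub s4s (bo _ lt_j).
  - by apply: boolean_sub s24 _; apply: boolean_sub s12 bc1.
  - exact: boolean_sub s4s (bc _ lt_j).
apply: (@reaches_weak _ _ _ _ _ (1 + (t * 400 + (100 + (1 + (100 + 10))))));
  [|by lia|by move=> s' _ H; exact: H].
apply: reaches_bind Q0 _ => s1 ss1 Q1.
have loop : reaches s1 (t * 400) (Q t).
  by apply: reaches_iter Q1 _ _ => // i s' lt_i s1s'; apply: Qstep => // x /ss1 /s1s'.
apply: reaches_bind loop _ => s2 s12 [bo bc pS].
have s2s : {subset s <= s2} by move=> x /ss1 /s12.
have byt : boolean s2 y'`_t by apply: boolean_sub s2s (by_ _ _); rewrite sz_y.
have bzt : boolean s2 z'`_t by apply: boolean_sub s2s (bz _ _); rewrite sz_z.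
have bct := bc t (leqnn t); have bct1 := bc t.-1 (leq_pred t).
apply: reaches_bind (boolean_bsum byt bzt bct) _ => s3 s23 bot.
have {}kp := s23 _ (s2s _ kp); have {}kq := s23 _ (s2s _ kq).
have kpq : computes s3 1 (p + q) by computes_by.
apply: reaches_bind kpq _ => s4 s34 {kp kq}kpq.
have s24 : {subset s2 <= s4} by move=> x /s23 /s34.
apply: reaches_bind (reaches_sub s24 (proves_sign_adder byt bzt bct1)) _.
rewrite -lc => s5 s45 pt.
have s25 : {subset s2 <= s5} by move=> x /s24 /s45.
have {}pS := s25 _ pS; have {}pp := s25 _ (s2s _ pp); have {}pq := s25 _ (s2s _ pq).
(* In position [t] the output bit is the sum of the two sign bits minus [c t]; this cancels the
   carry left in [S t] and leaves both sign bits with their negative weight. *)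
have e : tcval (ADD y z) - (p + q) = S t
    + - (2 ^+ t * (o t - (y'`_t + z'`_t - c t))) + (tcval y' - p) + (tcval z' - q).
  have es : \sum_(j < t) 2 ^+ j * (y'`_j + z'`_j) =
      \sum_(j < t) 2 ^+ j * y'`_j + \sum_(j < t) 2 ^+ j * z'`_j.
    by rewrite -big_split; apply: eq_bigr => j _; rewrite mulrDr.
  by rewrite eADD tcval_mkseq !(@tcvalE _ _ t) // /S es; ring.
have pADD : proves s5 10 (tcval (ADD y z) - (p + q)) by proves_by e.
apply: reaches_weak pADD _ _ => // s6 s56 {}pADD.
have s26 : {subset s2 <= s6} by move=> x /s25 /s56.
split; last by exists (c t.-1); [case: bct1 => /s26 | rewrite -ly -lz -lc eADD last_mkseq].
split=> //; last exact: s56 (s45 _ kpq).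
move=> i; rewrite eADD size_mkseq ltnS leq_eqVlt => /predU1P[->|lt_i].
  rewrite nth_mkseq //; apply: boolean_sub bot => x /s34 /s45; exact: s56.
by rewrite nth_mkseq ?ltnS 1?ltnW //; apply: boolean_sub s26 (bo _ lt_i).
Qed.

Lemma reaches_ADD0 s y z p q : represents s y p -> represents s z q ->
  proved s (last 0 y) -> proved s (last 0 z) ->
  reaches s (700 * (maxn (size y) (size z)).+1) (fun s' =>
    represents s' (ADD y z) (p + q) /\ proved s' (last 0 (ADD y z))).
Proof.
move=> ry rz py pz; set t := maxn _ _.
apply: (@reaches_weak _ _ _ _ _ (500 * t.+1 + 200)); [|lia|by move=> s' _ H; exact: H].
apply: reaches_bind (reaches_ADD ry rz) _ => s1 ss1 [rA [c kc lA]].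
have [[/ss1 ky _] [/ss1 kz _]] := (represents_last ry, represents_last rz).
have {}py := ss1 _ py; have {}pz := ss1 _ pz.
apply: reaches_weak (proves_sign_adder0 ky kz kc py pz) _ _ => // s2 s12.
by rewrite -lA; split=> //; apply: represents_sub rA.
Qed.

Lemma reaches_all s (c N : nat) (f : nat -> R) :
  (forall i s', (i < N)%N -> {subset s <= s'} -> reaches s' c (fun s2 => boolean s2 (f i))) ->
  reaches s (N * c) (fun s' => forall i, (i < N)%N -> boolean s' (f i)).
Proof.
move=> Hf; apply: (@reaches_iter _ _ ev1 ev2 N c
  (fun k s' => forall i, (i < k)%N -> boolean s' (f i))) => //.
  by move=> i s1 s2 s12 H j /H; apply: boolean_sub.
move=> i s' lt_i ss' H; apply: reaches_weak (Hf i s' lt_i ss') _ _ => // s2 s12 bi j.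
by rewrite ltnS leq_eqVlt => /predU1P[->|/H] //; apply: boolean_sub.
Qed.

Lemma reaches_xor_all s w p b : represents s w p -> boolean s b ->
  reaches s (100 * size w) (fun s' =>
    represents s' (xor_all b w) ((1 - 2 * b) * p - b)).
Proof.
move=> rw bb; have [w0 bw kp pp] := rw.
apply: (@reaches_weak _ _ _ _ _ (size w * 50 + (20 + 20))); [|lia|by move=> s' _ H; exact: H].
apply: reaches_bind (@reaches_all s 50 (size w) (fun i => bxor w`_i b) _) _.
  move=> i s' lt_i ss'; apply: boolean_bxor; apply: boolean_sub ss' _ => //.
  exact: bw.
move=> s1 ss1 bx; have [/ss1 kb _] := bb.
have {}kp := ss1 _ kp; have {}pp := ss1 _ pp.
have k1 : computes s1 20 ((1 - 2 * b) * p - b) by computes_by.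
apply: reaches_bind k1 _ => s2 s12 k2.
have {}kb := s12 _ kb; have {}pp := s12 _ pp.
have e : tcval (xor_all b w) - ((1 - 2 * b) * p - b) = (1 - 2 * b) * (tcval w - p).
  by rewrite tcval_xor_all //; ring.
have /reaches_weak H : proves s2 20 (tcval (xor_all b w) - ((1 - 2 * b) * p - b)).
  by proves_by e.
apply: H => // s3 s23 p3; split=> //; rewrite ?size_map //; last exact: s23.
move=> i lt_i; rewrite (nth_map 0) //.
by apply: boolean_sub (bx i lt_i) => x /s12 /s23.
Qed.

(** Passes from the polynomial that a construction yields to a simpler one equal to it modulo the
    axioms. *)
Lemma reaches_change s w p q : represents s w p -> known s q -> proved s (p - q) ->
  reaches s 1 (fun s' => represents s' w q).
Proof.
move=> [w0 bw kp pp] kq pq.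
have e : tcval w - q = (tcval w - p) + (p - q) by ring.
have /reaches_weak H : proves s 1 (tcval w - q) by proves_by e.
by apply: H => // s1 ss1 p1; split=> // [i /bw|]; [apply: boolean_sub | apply: ss1].
Qed.

(** The string of copies of the sign bit [b] has value [- b], so the result has value
    [(1 - 2 * b) * (p - b) - b], which is [(1 - 2 * b) * p] modulo [b ^ 2 - b]. Both summands have
    sign [b], hence so has their sum, and the exclusive or with [b] clears it. *)
Lemma reaches_ABS s y p : represents s y p ->
  reaches s (1000 * (size y).+1) (fun s' =>
    represents s' (ABS y) ((1 - 2 * last 0 y) * p) /\ proved s' (last 0 (ABS y))).
Proof.
move=> ry; have [y0 _ kp _] := ry; set b := last 0 y.
have bb : boolean s b := represents_last ry; have [kb pb] := bb.
apply: (@reaches_weak _ _ _ _ _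
  (3 + (1 + (500 * (maxn (size y) (size (nseq (size y) b))).+1 +
     (100 * (size y).+1 + (20 + (30 + (1 + 100))))))));
  [|by rewrite size_nseq maxnn; lia|by move=> s' _ H; exact: H].
have k3 : computes s 3 (- b) by computes_by.
apply: reaches_bind k3 _ => s1 ss1 kN.
have p1 := @proves0 _ _ ev1 ev2 s1; apply: reaches_bind p1 _ => s2 s12 p0.
have s2s : {subset s <= s2} by move=> x /ss1 /s12.
have rn : represents s2 (nseq (size y) b) (- b).
  split; rewrite ?size_nseq //; last by rewrite tcval_nseq // subrr.
    by move=> i lt_i; rewrite nth_nseq lt_i; apply: boolean_sub bb.
  exact: s12.
apply: reaches_bind (reaches_ADD (represents_sub s2s ry) rn) _.
move=> s3 s23 [rA [c kc lA]].
have s3s : {subset s <= s3} by move=> x /s2s /s23.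
have sz : size (ADD y (nseq (size y) b)) = (size y).+1.
  by rewrite size_ADD size_nseq maxnn.
have rX := reaches_xor_all rA (boolean_sub s3s bb).
rewrite sz in rX; apply: reaches_bind rX _ => s4 s34 rX.
have s4s : {subset s <= s4} by move=> x /s3s /s34.
have {}kb := s4s _ kb; have {}pb := s4s _ pb; have {}kp := s4s _ kp.
have {}kc := s34 _ kc.
have k4 : computes s4 20 ((1 - 2 * b) * p) by computes_by.
apply: reaches_bind k4 _ => s5 s45 k5.
have {}kb := s45 _ kb; have {}pb := s45 _ pb; have {}kp := s45 _ kp.
have {}kc := s45 _ kc.
have e : (1 - 2 * b) * (p - b) - b - (1 - 2 * b) * p = 2 * (b ^+ 2 - b) by ring.
have p5 : proves s5 30 ((1 - 2 * b) * (p - b) - b - (1 - 2 * b) * p).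
  by proves_by e.
apply: reaches_bind p5 _ => s6 s56 p6.
have s46 : {subset s4 <= s6} by move=> x /s45 /s56.
apply: reaches_bind (reaches_change (represents_sub s46 rX) (s56 _ k5) p6) _ => s7 s67 r7.
have s57 : {subset s5 <= s7} by move=> x /s56 /s67.
have {}kb := s57 _ kb; have {}pb := s57 _ pb; have {}kc := s57 _ kc.
(* With [u = b ^ 2 - b] and [K = 1 - (1 + b) * (2 - b) * c], the carry [maj b b c] is [b + u * K];
   after both exclusive ors a multiple of [u] remains. *)
have e' : last 0 (ABS y) = ((1 - (1 + b) * (2 - b) * c -
    2 * (1 - 2 * (b + (b ^+ 2 - b) * (1 - (1 + b) * (2 - b) * c)))) * (1 - 2 * b) - 2)
    * (b ^+ 2 - b).
  rewrite /ABS last_xor_all ?sz // -/b lA last_nseq // -/b.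
  by rewrite /bsum /maj /bxor /bor /band; ring.
have /reaches_weak H : proves s7 100 (last 0 (ABS y)) by proves_by e'.
by apply: H => // s8 s78 p8; split=> //; apply: represents_sub r7.
Qed.

End Arithmetic.

(** * Multiplication *)

Section Shift.
Variable R : comNzRingType.
Implicit Types (w y z : seq R) (b : R).

(** A row of schoolbook multiplication: [w] times the bit [b], moved up by [i] positions. *)
Definition shift (i : nat) b w : seq R := nseq i 0 ++ [seq band x b | x <- w].

Lemma size_shift i b w : size (shift i b w) = (i + size w)%N.
Proof. by rewrite size_cat size_nseq size_map. Qed.

Lemma last_shift i b w : (0 < size w)%N -> last 0 (shift i b w) = last 0 w * b.
Proof.
by case: w => // a w _; rewrite last_cat /=; apply: (last_map (fun x => band x b)).
Qed.

Lemma tcval_cons0 w : (0 < size w)%N -> tcval (0 :: w) = 2 * tcval w.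
Proof.
case: w => // a w _; rewrite (@tcvalE _ _ (size w).+1) // (@tcvalE _ _ (size w)) //.
rewrite big_ord_recl mulr0 add0r mulrBr mulr_sumr exprS -[2 * 2 ^+ _ * _]mulrA.
by congr (_ - _); apply: eq_bigr => j _; rewrite /bump /= exprS mulrA.
Qed.

Lemma tcval_shift i b w : (0 < size w)%N -> tcval (shift i b w) = 2 ^+ i * b * tcval w.
Proof.
move=> w0; elim: i => [|i IH].
  case: w w0 => // a w _; rewrite !(@tcvalE _ _ (size w)) ?size_shift //= expr0 mul1r.
  rewrite mulrBr mulr_sumr; congr (_ - _); last by rewrite (nth_map 0) // /band; ring.
  by apply: eq_bigr => j _; rewrite (nth_map 0) /= 1?ltnW // ?ltnS // /band; ring.
rewrite -[LHS]/(tcval (0 :: shift i b w)) tcval_cons0 ?size_shift ?addn_gt0 ?w0 ?orbT //.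
by rewrite IH exprS; ring.
Qed.

Lemma mkseq_shift i b w :
  mkseq (fun j => if (j < i)%N then 0 else band w`_(j - i) b) (size w + i) = shift i b w.
Proof.
apply: (@eq_from_nth _ 0); first by rewrite size_mkseq size_shift addnC.
move=> j; rewrite size_mkseq => lt_j; rewrite nth_mkseq // nth_cat size_nseq nth_nseq.
by case: ltnP => // le_i; rewrite (nth_map 0) // ltn_subLR // addnC.
Qed.

Definition PRODp_acc y z k : seq R :=
  foldl (fun acc i => ADD (shift i z`_i y) acc) (shift 0 z`_0 y) (iota 1 k).

Lemma PRODpE y z : PRODp y z = PRODp_acc y z (size y).-1.
Proof.
rewrite /PRODp /PRODp_acc mkseq_shift.
by elim: (iota 1 _) (shift 0 _ _) => //= i l IH acc; rewrite mkseq_shift IH.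
Qed.

Lemma PRODp_accS y z k :
  PRODp_acc y z k.+1 = ADD (shift k.+1 z`_k.+1 y) (PRODp_acc y z k).
Proof. by rewrite /PRODp_acc -[k.+1]addn1 iotaD foldl_cat /= addnC addn1. Qed.

(** The first addition lengthens the accumulator by two bits. From then on it is as long as the next
    row, and each addition lengthens it by one. *)
Lemma size_PRODp_acc y z k : (0 < size y)%N ->
  size (PRODp_acc y z k) = (size y + k + (0 < k))%N.
Proof.
move=> y0; elim: k => [|k IH]; first by rewrite size_shift !addn0.
by rewrite PRODp_accS size_ADD size_shift IH; lia.
Qed.

Lemma size_ABS w : size (ABS w) = (size w).+1.
Proof. by rewrite size_map size_ADD size_nseq maxnn. Qed.

(** Absolute values have [t + 1] bits, their product [2 * t + 2], and the final addition of the sign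
    gives one more: this is the product rule of the syntactic length. *)
Lemma size_PROD y z : (0 < maxn (size y) (size z))%N ->
  size (PROD y z) = (2 * maxn (size y) (size z) + 3)%N.
Proof.
set t := maxn _ _ => t0; rewrite size_ADD size_map PRODpE.
have sz : size (ABS (pad t y)) = t.+1 by rewrite size_ABS size_pad ?leq_maxl.
by rewrite size_PRODp_acc sz //=; lia.
Qed.

End Shift.

Section Products.
Variables (R : comNzRingType) (V : Type) (ev1 ev2 : V -> R).
Implicit Types (s : seq (R * R)) (b c p q g : R) (w y z : seq R).
Local Notation reaches := (reaches ev1 ev2).
Local Notation computes := (computes ev1 ev2).
Local Notation proves := (proves ev1 ev2).

Lemma reaches_shift s i b w p : represents s w p -> boolean s b -> known s 0 ->
  proved s (last 0 w) ->
  reaches s (20 * size w + 60) (fun s' =>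
    represents s' (shift i b w) (2 ^+ i * b * p) /\ proved s' (last 0 (shift i b w))).
Proof.
move=> rw bb k0 pl; have [w0 bw kp pp] := rw; have [kb _] := bb.
apply: (@reaches_weak _ _ _ _ _ (size w * 20 + (20 + (20 + 20))));
  [|lia|by move=> s' _ H; exact: H].
apply: reaches_bind (@reaches_all _ _ _ _ s 20 (size w) (fun i => band w`_i b) _) _.
  move=> j s' lt_j ss'; apply: boolean_band; apply: boolean_sub ss' _ => //.
  exact: bw.
move=> s1 ss1 bx.
have {}kp := ss1 _ kp; have {}pp := ss1 _ pp; have {}kb := ss1 _ kb.
have k1 : computes s1 20 (2 ^+ i * b * p) by computes_by.
apply: reaches_bind k1 _ => s2 s12 k2.
have {}kb := s12 _ kb; have {}pp := s12 _ pp.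
have e : tcval (shift i b w) - 2 ^+ i * b * p = 2 ^+ i * b * (tcval w - p).
  by rewrite tcval_shift //; ring.
have p2 : proves s2 20 (tcval (shift i b w) - 2 ^+ i * b * p) by proves_by e.
apply: reaches_bind p2 _ => s3 s23 p3.
have s13 : {subset s1 <= s3} by move=> x /s12 /s23.
have {}pl := s13 _ (ss1 _ pl); have {}kb := s23 _ kb.
have e' : last 0 (shift i b w) = b * last 0 w by rewrite last_shift // mulrC.
have /reaches_weak H : proves s3 20 (last 0 (shift i b w)) by proves_by e'.
apply: H => // s4 s34 p4; split=> //; split=> //; last exact: s34.
- by rewrite size_shift addn_gt0 w0 orbT.
- move=> j; rewrite size_shift => lt_j; rewrite nth_cat size_nseq nth_nseq.
  have s14 : {subset s1 <= s4} by move=> x /s13 /s34.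
  case: ltnP => [_|le_i].
    have k4 : known s4 0 := s14 _ (ss1 _ k0).
    by split=> //; rewrite expr0n subr0.
  rewrite (nth_map 0) ?ltn_subLR //; apply: boolean_sub s14 (bx _ _).
  by rewrite ltn_subLR.
- exact: s34 (s23 _ k2).
Qed.

(** All rows are multiples of [y] by a bit and inherit its sign bit 0, so [reaches_ADD0] keeps the
    accumulator nonnegative throughout. *)
Lemma reaches_PRODp s y z p q : represents s y p -> represents s z q ->
  size y = size z -> proved s (last 0 y) -> proved s (last 0 z) ->
  reaches s (2000 * (size y).+1 ^ 2) (fun s' =>
    represents s' (PRODp y z) (p * q) /\ proved s' (last 0 (PRODp y z))).
Proof.
move=> ry rz sz_yz py pz; set t := size y.
have [y0 _ kp _] := ry; have [_ bz kq pq] := rz.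
pose g k := \sum_(i < k.+1) 2 ^+ i * z`_i * p.
pose Q k s' := represents s' (PRODp_acc y z k) (g k) /\
               proved s' (last 0 (PRODp_acc y z k)).
apply: (@reaches_weak _ _ _ _ _
  (1 + ((20 * t + 60) + (t.-1 * (1500 * t.+1) + (1 + (30 + 1))))));
  [|rewrite /t; nia|by move=> s' _ H; exact: H].
have p1 := @proves0 _ _ ev1 ev2 s; apply: reaches_bind p1 _ => s1 ss1 p0.
have k0 : known s1 0 by [].
have bz1 i : (i < t)%N -> boolean s1 z`_i.
  by rewrite /t sz_yz => /bz; apply: boolean_sub.
have s0 := reaches_shift 0 (represents_sub ss1 ry) (bz1 0%N y0) k0 (ss1 _ py).
apply: reaches_bind s0 _ => s2 s12 Q0.
have loop : reaches s2 (t.-1 * (1500 * t.+1)) (Q t.-1).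
  apply: reaches_iter.
  - by rewrite /Q /g big_ord_recl big_ord0 addr0.
  - by move=> i s3 s4 s34 [r_i /s34 p_i]; split=> //; apply: represents_sub r_i.
  - move=> i s3 lt_i s23 [r_i p_i].
    have s13 : {subset s1 <= s3} by move=> x /s12 /s23.
    have s03 : {subset s <= s3} by move=> x /ss1 /s13.
    have lt_i1 : (i.+1 < t)%N by lia.
    apply: (@reaches_weak _ _ _ _ _ ((20 * t + 60) + 700 * (2 * t).+1));
      [|lia|by move=> s' _ H; exact: H].
    have si := reaches_shift i.+1 (represents_sub s03 ry)
      (boolean_sub s13 (bz1 _ lt_i1)) (s13 _ k0) (s03 _ py).
    apply: reaches_bind si _ => s4 s34 [rs ps].
    apply: reaches_weak (reaches_ADD0 rs (represents_sub s34 r_i) ps (s34 _ p_i)) _ _.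
      by rewrite size_shift size_PRODp_acc // /t leq_mul2l ltnS geq_max /=; lia.
    move=> s5 _ [rA pA]; rewrite /Q PRODp_accS; split=> //.
    by rewrite /g big_ord_recr /= addrC.
apply: reaches_bind loop _ => s3 s23; rewrite /Q -PRODpE => -[rP pP].
have s03 : {subset s <= s3} by move=> x /ss1 /s12 /s23.
have {}kp := s03 _ kp; have {}kq := s03 _ kq; have {}pq := s03 _ pq.
have {}pz := s03 _ pz.
have k1 : computes s3 1 (p * q) by computes_by.
apply: reaches_bind k1 _ => s4 s34 k4.
have {}kp := s34 _ kp; have {}pq := s34 _ pq; have {}pz := s34 _ pz.
(* The rows weigh the bits of [z] in plain binary, which exceeds [tcval z] by [2 ^ t] times its sign
   bit, and that bit is proved to be 0. *)
have e : g t.-1 - p * q = p * (tcval z - q) + 2 ^+ t * p * last 0 z.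
  have ht : t.-1.+1 = t := prednK y0.
  rewrite /g ht -mulr_suml /tcval -sz_yz -/t; ring.
have p4 : proves s4 30 (g t.-1 - p * q) by proves_by e.
apply: reaches_bind p4 _ => s5 s45 p5.
have s35 : {subset s3 <= s5} by move=> x /s34 /s45.
apply: reaches_weak (reaches_change (represents_sub s35 rP) (s45 _ k4) p5) _ _ => //.
by move=> s6 s56 r6; split=> //; exact: s56 (s35 _ pP).
Qed.

(** The product of the absolute values is corrected by the joint sign [c]: the exclusive or gives
    [(1 - 2 * c) * v - c], and adding [c] restores [(1 - 2 * c) * v]. If [c] is proved to be 0,
    every number involved has sign bit 0. *)
Lemma reaches_PROD s y z p q : represents s y p -> represents s z q ->
  reaches s (4 * 5000 * (maxn (size y) (size z)).+1 ^ 2) (fun s' =>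
    represents s' (PROD y z) (p * q) /\
    (proved s (bxor (last 0 y) (last 0 z)) -> proved s' (last 0 (PROD y z)))).
Proof.
move=> ry rz; set t := maxn _ _.
have le_y : (size y <= t)%N by rewrite leq_maxl.
have le_z : (size z <= t)%N by rewrite leq_maxr.
have t0 : (0 < t)%N by case: ry => y0 *; apply: leq_trans le_y.
set y' := pad t y; set z' := pad t z.
have ry' : represents s y' p by apply: represents_pad.
have rz' : represents s z' q by apply: represents_pad.
have sz_y : size y' = t by rewrite size_pad.
have sz_z : size z' = t by rewrite size_pad.
set a := last 0 y; set b := last 0 z; set c := bxor a b.
have ly : last 0 y' = a by exact: last_pad.
have lz : last 0 z' = b by exact: last_pad.
have ec : bxor y'`_t.-1 z'`_t.-1 = c by rewrite -{1}sz_y -sz_z !nth_last ly lz.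
pose P := PRODp (ABS y') (ABS z').
have ePROD : PROD y z = ADD (xor_all c P) [:: c; 0] by rewrite /PROD -/t -/y' -/z' ec.
have sz_P : (size P <= 2 * t.+1)%N.
  by rewrite /P PRODpE size_PRODp_acc size_ABS sz_y //=; lia.
have [_ _ kp _] := ry; have [_ _ kq _] := rz.
have ba : boolean s a := represents_last ry.
have bb : boolean s b := represents_last rz.
apply: (@reaches_weak _ _ _ _ _ (50 + (1 + (1000 * t.+1 + (1000 * t.+1 +
    (2000 * t.+2 ^ 2 + (100 * size P + (20 + (700 * (2 * t.+1).+1 + (1 + (100 + 1)))))))))));
  [| |by move=> s' _ H; exact: H]; last first.
  have h1 : (t.+2 ^ 2 <= 4 * t.+1 ^ 2)%N by rewrite -(expnMn 2 _ 2) leq_exp2r //; lia.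
  have h2 : (t.+1 <= t.+1 ^ 2)%N by rewrite leq_pmulr.
  by move: (t.+1 ^ 2)%N (t.+2 ^ 2)%N h1 h2 => u v h1 h2; lia.
apply: reaches_bind (boolean_bxor ba bb) _ => s1 ss1 bc.
have p1 := @proves0 _ _ ev1 ev2 s1; apply: reaches_bind p1 _ => s2 s12 p0.
have s02 : {subset s <= s2} by move=> x /ss1 /s12.
have aby := @reaches_ABS _ _ ev1 ev2 _ _ _ (represents_sub s02 ry'); rewrite sz_y ly in aby.
apply: reaches_bind aby _ => s3 s23 [rAy pAy].
have s03 : {subset s <= s3} by move=> x /s02 /s23.
have abz := @reaches_ABS _ _ ev1 ev2 _ _ _ (represents_sub s03 rz'); rewrite sz_z lz in abz.
apply: reaches_bind abz _ => s4 s34 [rAz pAz].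
have s24 : {subset s2 <= s4} by move=> x /s23 /s34.
have sz_A : size (ABS y') = size (ABS z') by rewrite !size_ABS sz_y sz_z.
have rP := reaches_PRODp (represents_sub s34 rAy) rAz sz_A (s34 _ pAy) pAz.
rewrite size_ABS sz_y -/P in rP.
apply: reaches_bind rP _ => s5 s45 [rP pP].
have s25 : {subset s2 <= s5} by move=> x /s24 /s45.
have bc5 : boolean s5 c by apply: boolean_sub bc => x /s12 /s25.
have [P0 _ _ _] := rP.
apply: reaches_bind (reaches_xor_all rP bc5) _ => s6 s56 rX.
have s26 : {subset s2 <= s6} by move=> x /s25 /s56.
have rc : represents s6 [:: c; 0] c.
  have bc6 := boolean_sub s56 bc5; have p6 : proved s6 0 := s26 _ p0.
  split=> //; last 1 first.
  - rewrite (@tcvalE _ _ 1) // big_ord_recl big_ord0 /=.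
    by have -> : 2 ^+ 0 * c + 0 - 2 ^+ 1 * 0 - c = 0 by ring.
  - case=> [|[|]] //= _; split=> //; by rewrite expr0n subr0.
  - by case: bc6.
pose W s' := represents s' (PROD y z) ((1 - 2 * c) * ((1 - 2 * a) * p * ((1 - 2 * b) * q)) - c + c)
  /\ (proved s c -> proved s' (last 0 (PROD y z))).
have lX : last 0 (xor_all c P) = (1 - 2 * c) * last 0 P + c.
  by rewrite last_xor_all // /bxor; ring.
have sz_X : (maxn (size (xor_all c P)) (size [:: c; 0%R]) <= 2 * t.+1)%N.
  by rewrite size_map geq_max sz_P /=; lia.
have hW : reaches s6 (20 + 700 * (2 * t.+1).+1) W.
  (* Membership of [(0, c)] in the program is decidable. If it holds, the sign bit is carried
     through the correction; otherwise plain addition suffices, the claim on the sign being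
     vacuous. *)
  have [pc|npc] := boolP ((0, c) \in s); last first.
    apply: reaches_weak (reaches_ADD rX rc) _ _; first by nia.
    move=> s7 _ [rA _]; rewrite /W ePROD; split=> // pc.
    by rewrite pc in npc.
  have {}pc : proved s6 c := s26 _ (s02 _ pc).
  have {}pP := s56 _ pP; have [/s56 kc _] := bc5.
  have pX : proves s6 20 (last 0 (xor_all c P)) by proves_by lX.
  apply: reaches_bind pX _ => s7 s67 pX.
  have pc0 : proved s7 (last 0 [:: c; 0]) := s67 _ (s26 _ p0).
  apply: reaches_weak
    (reaches_ADD0 (represents_sub s67 rX) (represents_sub s67 rc) pX pc0) _ _;
    first by rewrite leq_mul2l ltnS sz_X.
  by move=> s8 _ [rA pA]; rewrite /W ePROD.
rewrite addnA; apply: reaches_bind hW _ => s7 s67 [rW pW].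
have s07 : {subset s <= s7} by move=> x /s02 /s26 /s67.
have {}kp := s07 _ kp; have {}kq := s07 _ kq.
have k7 : computes s7 1 (p * q) by computes_by.
apply: reaches_bind k7 _ => s8 s78 k8.
have s08 : {subset s <= s8} by move=> x /s07 /s78.
have {}kp := s78 _ kp; have {}kq := s78 _ kq.
have [/s08 ka /s08 pa] := ba; have [/s08 kb /s08 pb] := bb.
(* The factor [1 - 2 * c] equals [(1 - 2 * a) * (1 - 2 * b)], and the square of [1 - 2 * a] is
   [1 + 4 * (a ^ 2 - a)]. *)
have e : (1 - 2 * c) * ((1 - 2 * a) * p * ((1 - 2 * b) * q)) - c + c - p * q =
  p * q * (4 * (1 + 4 * (b ^+ 2 - b)) * (a ^+ 2 - a) + 4 * (b ^+ 2 - b)).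
  by rewrite /c /bxor; ring.
have p8 : proves s8 100 ((1 - 2 * c) * ((1 - 2 * a) * p * ((1 - 2 * b) * q)) - c + c - p * q).
  by proves_by e.
apply: reaches_bind p8 _ => s9 s89 p9.
have s79 : {subset s7 <= s9} by move=> x /s78 /s89.
apply: reaches_weak (reaches_change (represents_sub s79 rW) (s89 _ k8) p9) _ _ => //.
by move=> s10 s910 r10; split=> // /pW pl; exact: s910 (s79 _ pl).
Qed.

End Products.

(** * Two's complement bits of integer constants *)

Lemma int_lenP a : fits a (int_len a).
Proof. by rewrite /int_len; case: ex_minnP. Qed.

Lemma int_len_gt0 a : (0 < int_len a)%N.
Proof. by case/andP: (int_lenP a). Qed.

Lemma modn_pow2S v N : (v %% 2 ^ N.+1 = v %% 2 ^ N + 2 ^ N * odd (v %/ 2 ^ N))%N.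
Proof.
have pN : (0 < 2 ^ N)%N by rewrite expn_gt0.
rewrite {1}(divn_eq v (2 ^ N)) {1}(divn_eq (v %/ 2 ^ N) 2) modn2 mulnDl -mulnA -expnS -addnA.
rewrite modnMDl modn_small; first by rewrite addnC mulnC.
rewrite expnS mul2n -addnn -addSn; have := ltn_pmod v pN; case: (odd _); lia.
Qed.

Lemma binary_sum (R : comNzRingType) v N :
  \sum_(i < N) 2 ^+ i * (odd (v %/ 2 ^ i))%:R = (v %% 2 ^ N)%:R :> R.
Proof.
elim: N => [|N IH]; first by rewrite big_ord0 expn0 modn1.
by rewrite big_ord_recr /= IH modn_pow2S natrD natrM natrX.
Qed.

(** For [a >= 0] the residue is [a] itself, below [2 ^ k], with top bit 0. For [a < 0] it is
    [u + 2 ^ k] with [u = a + 2 ^ k] in [[0, 2 ^ k)], so the top bit is 1 and the value is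
    [u - 2 ^ k = a]. *)
Lemma int_bits_spec (R : comNzRingType) a :
  tcval (int_bits R a) = a%:~R /\ (0 <= a -> last 0 (int_bits R a) = 0).
Proof.
have := int_lenP a; rewrite /int_bits; cbv zeta; case: (int_len a) => // k /andP[_ /andP[lo hi]].
rewrite /= in lo hi.
have pk : (0 < 2 ^ k)%N by rewrite expn_gt0.
set v := `|(a %% 2 ^+ k.+1)%Z|%N.
rewrite last_mkseq tcval_mkseq binary_sum.
have [a0|a0] := leP 0 a.
  case: a a0 lo hi @v => // a _ _ hi v.
  have lt_a : (a < 2 ^ k)%N by move: hi; rewrite -natz -natrX ltr_nat.
  have -> : v = a.
    rewrite /v -natz -natrX natz natz modz_nat absz_nat modn_small //.
    by rewrite expnS mul2n -addnn ltn_addl.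
  by rewrite divn_small // modn_small // mulr0 subr0.
have ev : v%:Z = a + 2 ^+ k.+1.
  have p : 0 <= a + 2 ^+ k.+1.
    by rewrite exprS mulr_natl mulr2n addrA -lerBlDr sub0r ler_wpDr ?exprn_ge0 // -lerBlDr sub0r.
  rewrite /v gez0_abs ?modz_ge0 ?expf_neq0 // -(modzDr a) modz_small // p.
  by rewrite gtrDr.
have ev' : v%:Z = (a + 2 ^+ k) + (2 ^ k)%N%:Z.
  by rewrite ev exprS -[(2 ^ k)%N%:Z]natz natrX; ring.
have [u eu] : exists u : nat, u%:Z = a + 2 ^+ k.
  by exists (absz (a + 2 ^+ k)); rewrite gez0_abs // -lerBlDr sub0r.
have evu : v = (u + 2 ^ k)%N by apply/eqP; rewrite -eqz_nat ev' -eu PoszD.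
have lt_u : (u < 2 ^ k)%N.
  by rewrite -(ltr_nat int) !natz eu -[(2 ^ k)%N%:Z]natz natrX gtrDr.
split=> //; rewrite evu modnDr modn_small // divnDr // divnn pk divn_small //= mulr1.
have -> : a = u%:Z - 2 ^+ k by rewrite eu; ring.
by rewrite rmorphB rmorphXn /= -pmulrn.
Qed.

Section IntBits.
Variables (R : comNzRingType) (V : Type) (ev1 ev2 : V -> R).
Implicit Types (s : seq (R * R)).
Local Notation reaches := (reaches ev1 ev2).

(** The bits are the constants 0 and 1: their boolean axioms and the claim on the value are formally
    0, so one proof of 0 serves for all of them. *)
Lemma reaches_int_bits s a : reaches s (2 + int_len a) (fun s' =>
  represents s' (int_bits R a) a%:~R /\ (0 <= a -> proved s' (last 0 (int_bits R a)))).
Proof.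
have [v_a l_a] := int_bits_spec R a.
apply: (@reaches_weak _ _ _ _ _ (1 + (1 + int_len a * 1)));
  [|by rewrite muln1|by move=> s' _ H; exact: H].
have p1 := @proves0 _ _ ev1 ev2 s; apply: reaches_bind p1 _ => s1 ss1 p0.
have k1 := @computes_int _ _ ev1 ev2 s1 a; apply: reaches_bind k1 _ => s2 s12 k2.
have p2 := s12 _ p0.
apply: reaches_weak (@reaches_all _ _ _ _ s2 1 (int_len a) (fun i => (int_bits R a)`_i) _) _ _.
- move=> i s3 lt_i s23; rewrite nth_mkseq //.
  have /reaches_weak H := @computes_nat _ _ ev1 ev2 s3
     (odd (`|(a %% 2 ^+ int_len a)%Z| %/ 2 ^ i)).
  apply: H => // s4 s34 k4; split=> //.
  by case: (odd _); rewrite ?expr1n ?expr0n subrr; apply/s34/s23.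
- by [].
- move=> s3 s23 bi; split=> [|/l_a ->]; last exact: s23.
  split; rewrite ?size_mkseq ?int_len_gt0 //; first exact: s23.
  by rewrite v_a subrr; apply: s23.
Qed.
End IntBits.

(** * Node values as a recursion on the DAG *)

Section Nodes.
Variables (V A : Type) (fv : V -> A) (fc : int -> A) (fa fm : A -> A -> A).
Implicit Types (l : seq (gate V)).
Local Notation vals := (node_vals fv fc fa fm).

Lemma node_vals_cat l1 l2 : take (size l1) (vals (l1 ++ l2)) = vals l1.
Proof.
elim/last_ind: l2 => [|l2 g IH]; first by rewrite cats0 take_oversize ?size_node_vals.
rewrite -rcons_cat node_vals_rcons -cats1 takel_cat ?IH //.
by rewrite size_node_vals size_cat leq_addr.
Qed.

Lemma nth_node_vals_cat l1 l2 k x : (k < size l1)%N ->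
  nth x (vals (l1 ++ l2)) k = nth x (vals l1) k.
Proof. by move=> lt_k; rewrite -(node_vals_cat l1 l2) nth_take. Qed.

Definition node_val l k : A := nth (fc 0) (vals l) k.

(** A gate sees only the values before it, and later gates do not change these, so the left fold
    satisfies the recursive equation used for induction on nodes. *)
Lemma node_valE l k : ordered_from 0 l -> (k < size l)%N ->
  node_val l k = match nth (Const 0) l k with
    | Var v => fv v | Const c => fc c
    | Add i j => fa (node_val l i) (node_val l j)
    | Mul i j => fm (node_val l i) (node_val l j) end.
Proof.
move=> ord_l lt_k; rewrite -(cat_take_drop k l) (drop_nth (Const 0) lt_k) in ord_l *.
set l1 := take k l in ord_l *; set g := nth _ l k in ord_l *; set l2 := drop _ l in ord_l *.
have sz1 : size l1 = k by rewrite size_takel // ltnW.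
have -> : nth (Const 0) (l1 ++ g :: l2) k = g by rewrite nth_cat sz1 ltnn subnn.
have lt_g : all (fun i => i < k)%N (gate_args g).
  by move: ord_l; rewrite ordered_from_cat /= sz1 add0n => /and3P[].
have nvE i : (i < k)%N -> node_val (l1 ++ g :: l2) i = nth (fc 0) (vals l1) i.
  by move=> lt_i; rewrite /node_val nth_node_vals_cat ?sz1.
have -> : node_val (l1 ++ g :: l2) k = gate_val fv fc fa fm (vals l1) g.
  rewrite /node_val -cat_rcons nth_node_vals_cat ?size_rcons ?sz1 //.
  by rewrite node_vals_rcons nth_rcons size_node_vals sz1 ltnn eqxx.
by case: g lt_g {ord_l} nvE => //= i j /and3P[lt_i lt_j _] nvE; rewrite !nvE.
Qed.

Lemma gate_args_lt l k : ordered_from 0 l -> (k < size l)%N ->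
  all (fun i => i < k)%N (gate_args (nth (Const 0) l k)).
Proof.
move=> ord_l lt_k; move: ord_l.
rewrite -{1}(cat_take_drop k l) (drop_nth (Const 0) lt_k) ordered_from_cat /=.
by rewrite size_takel 1?ltnW // => /and3P[].
Qed.
End Nodes.

(** * The bits of the nodes of a circuit *)

Section CircuitBits.
Variable n : nat.
Implicit Types (l : seq (gate 'I_n)).

Definition node_bits l : nat -> seq {mpoly int[n]} :=
  node_val (fun j => [:: 'X_j; 0]) (@int_bits _) (@ADD _) (@PROD _) l.
Definition node_len l : nat -> nat :=
  node_val (fun _ => 2) int_len (fun a b => (maxn a b).+1)
    (fun a b => (2 * maxn a b + 3)%N) l.
Definition node_poly l : nat -> {mpoly int[n]} :=
  node_val (fun i => 'X_i) (fun c => c%:~R) +%R *%R l.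

Lemma node_len_gt0 l k : ordered_from 0 l -> (k < size l)%N -> (0 < node_len l k)%N.
Proof.
move=> ord_l lt_k; rewrite /node_len node_valE //.
by case: nth => // [c|i j]; rewrite ?int_len_gt0 ?addn3.
Qed.

Lemma size_node_bits l k : ordered_from 0 l -> (k < size l)%N ->
  size (node_bits l k) = node_len l k.
Proof.
move=> ord_l; elim/ltn_ind: k => k IH lt_k.
have := gate_args_lt ord_l lt_k.
rewrite /node_bits /node_len !node_valE //.
case: nth => // [c _|i j|i j]; first by rewrite size_mkseq.
all: rewrite [all _ _]/= => /and3P[lt_i lt_j _]; rewrite -!/(node_bits _ _) -!/(node_len _ _).
all: have lt_ik := ltn_trans lt_i lt_k; have lt_jk := ltn_trans lt_j lt_k.
  by rewrite size_ADD !IH.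
rewrite size_PROD !IH // leq_max node_len_gt0 //.
Qed.

Lemma tr_last (G : circuit 'I_n) : tr G = last 0 (cbit G).
Proof.
have /andP[ord_G lt_G] := circuitP G.
by rewrite /tr -nth_last -[clen G](size_node_bits ord_G lt_G).
Qed.

End CircuitBits.

(** * Gate by gate simulation of a circuit *)

Section Simulation.
Variables (R : comNzRingType) (V : Type) (ev1 ev2 : V -> R).
Implicit Types (s : seq (R * R)).

Lemma proves_bxor s a b : known s a -> known s b -> proved s a -> proved s b ->
  proves ev1 ev2 s 10 (bxor a b).
Proof.
move=> ka kb pa pb; have e : bxor a b = (1 - 2 * b) * a + b by rewrite /bxor; ring.
by proves_by e.
Qed.

(** For a square the joint sign vanishes by the boolean axiom alone; this is where squares become
    nonnegative. *)
Lemma proves_bxor_same s a : boolean s a -> proves ev1 ev2 s 10 (bxor a a).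
Proof.
move=> [ka pa]; have e : bxor a a = - 2 * (a ^+ 2 - a) by rewrite /bxor; ring.
by proves_by e.
Qed.
End Simulation.

Section SimulateCircuit.
Variables (n : nat) (V : Type) (ev1 ev2 : V -> {mpoly int[n]}).
Variables (l : seq (gate 'I_n)) (t : nat) (Good : nat -> Prop).
Hypothesis ord_l : ordered_from 0 l.
Hypothesis ax_bool : forall i s, reaches ev1 ev2 s 2 (fun s' => boolean s' 'X_i).
Local Notation reaches := (reaches ev1 ev2).

(** The local rules of nonnegativity; a square, [i = j], asks nothing of its argument. *)
Definition positive_gate (k : nat) : Prop :=
  match nth (Const 0) l k with
  | Var _ => False
  | Const c => 0 <= c
  | Add i j => Good i /\ Good j
  | Mul i j => i = j \/ Good i /\ Good j
  end.

Definition node_ok s k : Prop :=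
  represents s (node_bits l k) (node_poly l k) /\
  (Good k -> proved s (last 0 (node_bits l k))).

Lemma node_ok_sub s s' k : {subset s <= s'} -> node_ok s k -> node_ok s' k.
Proof. by move=> ss' [/(represents_sub ss') rk pk]; split=> // /pk; apply: ss'. Qed.

(** Arguments of a node of length at most [t] have length at most [t], so one bound holds for every
    addition and product that occurs. *)
Lemma reaches_node s k : (k < size l)%N -> (node_len l k <= t)%N ->
  (forall i, (i < k)%N -> (node_len l i <= t)%N -> node_ok s i) ->
  reaches s (10 + 4 * 5000 * t.+1 ^ 2) (fun s' =>
    represents s' (node_bits l k) (node_poly l k) /\
    (positive_gate k -> proved s' (last 0 (node_bits l k)))).
Proof.
move=> lt_k le_t IH; have := gate_args_lt ord_l lt_k.
have h2 : (t.+1 <= t.+1 ^ 2)%N by rewrite leq_pmulr.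
move: le_t; rewrite /node_bits /node_poly /node_len /positive_gate !node_valE //.
case: nth => [v|c|i j|i j] le_t.
- move=> _; apply: (@reaches_weak _ _ _ _ _ (1 + 2 + 1)); [|by lia|by move=> s' _ H; exact: H].
  rewrite -addnA; have p1 := @proves0 _ _ ev1 ev2 s; apply: reaches_bind p1 _ => s1 ss1 p0.
  apply: reaches_bind (@ax_bool v s1) _ => s2 s12 bv.
  have e : tcval [:: 'X_v; 0] - 'X_v = 0 :> {mpoly int[n]}.
    by rewrite (@tcvalE _ _ 1) // big_ord_recl big_ord0 /= expr0; ring.
  have p2 := s12 _ p0; apply: reaches_ret => s3 s23.
  have {}p2 := s23 _ p2; have {}bv := boolean_sub s23 bv.
  split=> //; split=> //; last by rewrite /proved e.
    by case=> [|[|]] //= _; split=> //; rewrite /proved expr0n subr0.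
  by case: bv.
- by move=> _; apply: reaches_weak (@reaches_int_bits _ _ ev1 ev2 s c) _ _ => //; lia.
all: rewrite -!/(node_bits _ _) -!/(node_len _ _) -!/(node_poly _ _) in le_t *.
all: rewrite [all _ _]/= => /and3P[lt_i lt_j _].
all: have [le_i le_j] : (node_len l i <= t)%N /\ (node_len l j <= t)%N by lia.
all: have [ri gi] := IH i lt_i le_i; have [rj gj] := IH j lt_j le_j.
all: have sz_i := size_node_bits ord_l (ltn_trans lt_i lt_k).
all: have sz_j := size_node_bits ord_l (ltn_trans lt_j lt_k).
(* [Good] is an arbitrary proposition, so excluded middle decides whether a sign has to be proved
   too. *)
- have [[/gi pi /gj pj]|ng] := classic (Good i /\ Good j).
    apply: reaches_weak (reaches_ADD0 ri rj pi pj) _ _; rewrite ?sz_i ?sz_j; first by lia.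
    by move=> s' _ [].
  apply: reaches_weak (reaches_ADD ri rj) _ _; rewrite ?sz_i ?sz_j; first by lia.
  by move=> s' _ [].
- have hx : reaches s 10 (fun s' => i = j \/ Good i /\ Good j ->
      proved s' (bxor (last 0 (node_bits l i)) (last 0 (node_bits l j)))).
    have bi := represents_last ri; have bj := represents_last rj.
    have [eij|nij] := classic (i = j).
      by rewrite -eij; apply: reaches_weak (proves_bxor_same bi) _ _.
    have [[/gi pi /gj pj]|ng] := classic (Good i /\ Good j); last first.
      by apply: reaches_ret => s' _ [].
    by apply: reaches_weak (proves_bxor (proj1 bi) (proj1 bj) pi pj) _ _.
  apply: reaches_bind hx _ => s1 ss1 px.
  apply: reaches_weak (reaches_PROD (represents_sub ss1 ri) (represents_sub ss1 rj)) _ _.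
    rewrite sz_i sz_j leq_mul2l leq_exp2r // orbC; apply/orP; left; lia.
  by move=> s2 s12 [rP pP]; split=> // /px.
Qed.

Hypothesis good_gate : forall k, (k < size l)%N -> Good k ->
  positive_gate k \/ exists v, (ev1 v, ev2 v) = (0, last 0 (node_bits l k)).

(** Nodes are treated in order. The sign of a good node follows from its arguments or is itself an
    axiom, which costs one more gate. *)
Lemma reaches_nodes s :
  reaches s (size l * (11 + 4 * 5000 * t.+1 ^ 2)) (fun s' =>
    forall k, (k < size l)%N -> (node_len l k <= t)%N -> node_ok s' k).
Proof.
apply: (@reaches_iter _ _ ev1 ev2 (size l) _ (fun N s' =>
  forall k, (k < N)%N -> (node_len l k <= t)%N -> node_ok s' k)) => //.
  by move=> N s1 s2 s12 H k lt_k /(H k lt_k); apply: node_ok_sub.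
move=> N s1 lt_N _ IH.
suff /reaches_weak hN : reaches s1 (11 + 4 * 5000 * t.+1 ^ 2)
    (fun s' => (node_len l N <= t)%N -> node_ok s' N).
  apply: hN => // s2 s12 okN k; rewrite ltnS leq_eqVlt => /predU1P[->|lt_k] // le_t.
  exact: node_ok_sub s12 (IH k lt_k le_t).
have [le_t|gt_t] := leqP (node_len l N) t; last first.
  by apply: reaches_ret.
rewrite -[11%N]/(1 + 10)%N -addnA [(1 + _)%N]addnC.
apply: reaches_bind (reaches_node lt_N le_t IH) _ => s2 s12 [rN pN].
have [/(good_gate lt_N)[/pN p2|[v ev]]|ng] := classic (Good N).
- by apply: reaches_ret => s3 s23 _; apply: node_ok_sub s23 _.
- have jv : justified ev1 ev2 s2 (ev1 v, ev2 v) by apply: Or41; exists v.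
  apply: reaches_weak (reaches_gate jv) _ _ => // s3 s23; rewrite ev => p3 _.
  by split=> //; apply: represents_sub s23 _.
- by apply: reaches_ret => s3 s23 _; split=> //; apply: represents_sub s23 _.
Qed.

End SimulateCircuit.

(** * Nonnegative nodes of a conic circuit *)

Section Composition.
Variables (n m : nat) (C : circuit ('I_n + 'I_m)) (H : 'I_m -> circuit 'I_n).
Local Notation place := (place H).
Local Notation place_size := (place_size H).
Local Notation used := (used C).
Local Notation redirect := (redirect C H).

Lemma place_cat b js1 js2 :
  place b (js1 ++ js2) = place b js1 ++ place (b + place_size js1)%N js2.
Proof.
elim: js1 b => [|j js1 IH] b /=; first by rewrite addn0.
by rewrite IH catA addnA.
Qed.

Lemma node_vals_shift (A : Type) (fv : 'I_n -> A) fc fa fm (l1 l2 : seq (gate 'I_n)) :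
  ordered_from 0 l2 ->
  node_vals fv fc fa fm (l1 ++ map (shift_gate (size l1)) l2) =
  node_vals fv fc fa fm l1 ++ node_vals fv fc fa fm l2.
Proof.
elim/last_ind: l2 => [|l2 g IH]; first by rewrite !cats0.
rewrite ordered_from_rcons => /andP[/IH {}IH lt_g].
rewrite map_rcons -rcons_cat !node_vals_rcons IH -rcons_cat; congr rcons.
have nthE i : (i < size l2)%N -> nth (fc 0)
    (node_vals fv fc fa fm l1 ++ node_vals fv fc fa fm l2) (size l1 + i) =
    nth (fc 0) (node_vals fv fc fa fm l2) i.
  by move=> lt_i; rewrite nth_cat size_node_vals ltnNge leq_addr addKn.
by case: g lt_g => //= i j /and3P[lt_i lt_j _]; rewrite !nthE.
Qed.

(** The copy of [H j] refers only to its own nodes, so every fold, in particular the bits, takes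
    there the value it has on [H j]. *)
Lemma node_val_place_out (A : Type) (fv : 'I_n -> A) fc fa fm j : j \in used ->
  node_val fv fc fa fm (ccomp_nodes C H) (place_out C H j) = cfold fv fc fa fm (H j).
Proof.
move=> uj; have iu : (index j used < size used)%N by rewrite index_mem.
have /andP[ord_j lt_j] := circuitP (H j).
have -> : ccomp_nodes C H = place 0 (take (index j used) used) ++
    map (shift_gate (place_size (take (index j used) used))) (nodes (H j)) ++
    (place (place_size (take (index j used) used) + csize (H j)) (drop (index j used).+1 used)
       ++ pmap (redirect_gate C H) (nodes C)).
  rewrite /ccomp_nodes -{1}(cat_take_drop (index j used) used) (drop_nth j iu) nth_index //.
  by rewrite place_cat add0n /= !catA.
rewrite /place_out; set js := take _ _; have <- : size (place 0 js) = place_size js.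
  exact: size_place.
rewrite catA /node_val nth_node_vals_cat; last by rewrite size_cat size_map ltn_add2l.
by rewrite node_vals_shift // nth_cat size_node_vals ltnNge leq_addr addKn.
Qed.

Lemma gate_at_redirect k g : (k < size (nodes C))%N ->
  redirect_gate C H (gate_at C k) = Some g ->
  nth (Const 0) (ccomp_nodes C H) (redirect k) = g.
Proof.
move=> lt_k gk; have -> : redirect k =
    (place_size used + count (@top_node n m) (take k (nodes C)))%N.
  by rewrite /redirect; case: (gate_at C k) gk => [[i|j]|||].
rewrite nth_cat size_place ltnNge leq_addr addKn.
have -> : pmap (redirect_gate C H) (nodes C) =
    pmap (redirect_gate C H) (take k (nodes C)) ++
    g :: pmap (redirect_gate C H) (drop k.+1 (nodes C)).
  rewrite -[in LHS](cat_take_drop k (nodes C)) (drop_nth (Const 0) lt_k) pmap_cat /=.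
  by rewrite -/(gate_at C k) gk.
by rewrite nth_cat size_redirect ltnn subnn.
Qed.

(* [k] itself is allowed to be a squaring gate, since its value is nonnegative
   whatever its argument. *)
Definition exposed (k : nat) : Prop := exists p : seq nat,
  [/\ path (edge C) k p, last k p = out C & ~~ has (squaring C) p].

Lemma exposed_edge i k : edge C i k -> ~~ squaring C k -> exposed k -> exposed i.
Proof.
move=> ik nk [p [p1 p2 p3]]; exists (k :: p).
by rewrite /= ik p1 p2 (negbTE nk).
Qed.

(** Several leaves of [C] with the same variable are redirected to one copy, so exposure is asked of
    some preimage. *)
Definition exposed_node (r : nat) : Prop :=
  exists k, [/\ (k < size (nodes C))%N, redirect k = r & exposed k].

Lemma exposed_out : exposed_node (redirect (out C)).
Proof.
by exists (out C); split=> //; [case/andP: (circuitP C) | exists [::]].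
Qed.

(** Conicity rules out [x]-variables and negative constants; a gate that is not a squaring passes
    exposure to its arguments; a leaf [y_j] leads to the output of [H j], whose sign is an axiom. *)
Lemma exposed_gate r : conic C -> exposed_node r ->
  positive_gate (ccomp_nodes C H) exposed_node r \/
  exists2 j, j \in used & r = place_out C H j.
Proof.
move=> conicC [k [lt_k <- xk]]; have /andP[ord_C _] := circuitP C.
have lt_args := gate_args_lt ord_C lt_k; rewrite -/(gate_at C k) in lt_args.
have up i : edge C i k -> ~~ squaring C k -> exposed_node (redirect i).
  move=> ik nk; exists i; split=> //; last exact: exposed_edge xk.
  by apply: ltn_trans lt_k; apply: (allP lt_args).
(* The path in [exposed] avoids squarings only above [k], whereas [conic] also counts [k] itself,
   hence the assumption that [k] is not one. *)
have not_guarded : ~~ squaring C k -> guarded_leaf C k -> False.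
  move=> nk gk; case: xk => p [p1 p2 p3].
  by have := conicC k p gk p1 p2; rewrite /= (negbTE nk) (negbTE p3).
have outE j : gate_at C k = Var (inr j) -> redirect k = place_out C H j.
  by rewrite /redirect => ->.
rewrite /positive_gate.
move: (@gate_at_redirect k) up not_guarded (@mem_used n m C k) outE.
rewrite /edge /squaring /guarded_leaf.
case: (gate_at C k) => [[i|j]|c|i j|i j] gE up ng mu outE.
- by case: ng.
- by right; exists j; [apply: mu | apply: outE].
- left; rewrite (gE (Const c)) //; by case: leP => // c0; case: ng.
- by left; rewrite (gE (Add (redirect i) (redirect j))) //;
    split; apply: up; rewrite //= !inE eqxx ?orbT.
- left; rewrite (gE (Mul (redirect i) (redirect j))) //.
  have [->|nij] := eqVneq i j; first by left.
  by right; split; apply: up; rewrite //= !inE eqxx ?orbT.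
Qed.

End Composition.

(** * Substitution into a refutation of the binary value principle *)

Lemma ceval_morph (R S : comNzRingType) (V : Type) (phi : {rmorphism R -> S})
    (v : V -> R) (v' : V -> S) (D : circuit V) : (forall x, v' x = phi (v x)) ->
  ceval v' D = phi (ceval v D).
Proof.
move=> ev; rewrite /ceval /cfold.
suff -> : node_vals v' (fun c : int => c%:~R) +%R *%R (nodes D) =
    map phi (node_vals v (fun c : int => c%:~R) +%R *%R (nodes D)).
  have /andP[_ lt_o] := circuitP D.
  by rewrite (nth_map 0%:~R) ?size_node_vals.
elim/last_ind: (nodes D) => // l g IH; rewrite !node_vals_rcons map_rcons IH; congr rcons.
have nthE i : nth 0%:~R (map phi (node_vals v (fun c : int => c%:~R) +%R *%R l)) i =
   phi (nth 0%:~R (node_vals v (fun c : int => c%:~R) +%R *%R l) i).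
  have [lt_i|ge_i] := ltnP i (size (node_vals v (fun c : int => c%:~R) +%R *%R l)).
    by rewrite (nth_map 0%:~R).
  by rewrite !nth_default ?size_map // rmorph_int.
by case: g => [w|c|i j|i j] /=; rewrite ?nthE ?rmorph_int ?rmorphD ?rmorphM.
Qed.

Section BinaryValue.
Variables (n : nat) (V : Type) (ev1 ev2 : V -> {mpoly int[n]}).
Local Notation reaches := (reaches ev1 ev2).
Local Notation proves := (proves ev1 ev2).

(** Once the sign bit is 0, the value [-1] turns into a proof that the plain binary sum of the bits
    plus 1 is 0. That is the axiom of [B] with the bits for its variables. *)
Lemma reaches_bvp (t : nat) (B : circuit (ips_var t 1)) M s w :
  ips_proof (fun _ => bvp t 1) M%:MP B -> size w = t ->
  represents s w (-1) -> proved s (last 0 w) ->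
  reaches s (10 + csize B) (fun s' => proved s' M%:MP).
Proof.
move=> [B0 BM] sz_w [_ bw _ pw] pl.
pose g := \sum_(i < t) 2 ^+ i * w`_i + 1.
have e : g = (tcval w - (-1)) + 2 ^+ t * last 0 w.
  by rewrite /tcval sz_w /g; ring.
have pg : proves s 5 g by proves_by e.
rewrite -[10%N]/(5 + (1 + 4))%N -!addnA; apply: reaches_bind pg _ => s1 ss1 {}pg.
have p1 := @proves0 _ _ ev1 ev2 s1; apply: reaches_bind p1 _ => s2 s12 p0.
pose lq := [tuple w`_i | i < t].
(* Replacing variables by bits turns the axiom into [g] and boolean axioms into those of the bits,
   all present already; the constant [M] is unchanged. *)
pose u1 v := comp_mpoly lq (ips_subst (fun _ : 'I_1 => 0) (fun _ : 'I_t => 0) v).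
pose u2 v := comp_mpoly lq (ips_subst (fun _ : 'I_1 => bvp t 1) (fun i => 'X_i ^+ 2 - 'X_i) v).
have su v : (u1 v, u2 v) \in s2.
  have XE (i : 'I_t) : 'X_i \mPo lq = w`_i by rewrite comp_mpolyXU -tnth_nth tnth_mktuple.
  have bi (i : 'I_t) : boolean s2 w`_i.
    by apply: boolean_sub (bw i _); rewrite ?sz_w // => x /ss1 /s12.
  case: v => [i|j|i]; rewrite /u1 /u2 /ips_subst.
  - by rewrite XE; case: (bi i).
  - rewrite comp_mpoly0 /bvp comp_mpolyD comp_mpolyC raddf_sum /=.
    rewrite (eq_bigr (fun i : 'I_t => 2 ^+ i * w`_i)); last first.
      by move=> i _; rewrite comp_mpolyZ XE -mul_mpolyC rmorphXn /= rmorph_nat.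
    exact: s12 _ pg.
  - by rewrite comp_mpoly0 rmorphB rmorphXn /= XE; case: (bi i).
apply: reaches_weak (reaches_circuit B su) _ _; first by rewrite leq_addl.
move=> s3 s23; rewrite (ceval_morph B (v := ips_subst (fun=> 0) (fun=> 0))
  (phi := comp_mpoly lq) (fun=> erefl)) B0.
rewrite (ceval_morph B (v := ips_subst (fun=> bvp t 1) (fun i => 'X_i ^+ 2 - 'X_i))
  (phi := comp_mpoly lq) (fun=> erefl)) BM.
by rewrite rmorph0 /= comp_mpolyC.
Qed.
End BinaryValue.

(** * The IPS refutation and its size *)

Section Main.
Variables (n m : nat) (H : 'I_m -> circuit 'I_n).
Let ev1 : ips_var n m -> {mpoly int[n]} := ips_subst (fun _ => 0) (fun _ => 0).
Let ev2 : ips_var n m -> {mpoly int[n]} :=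
  ips_subst (fun j => tr (H j)) (fun i => 'X_i ^+ 2 - 'X_i).

Lemma reaches_boolean_var (i : 'I_n) s :
  reaches ev1 ev2 s 2 (fun s' => boolean s' 'X_i).
Proof.
apply: (@boolean_intro _ _ _ _ _ 1 1); apply: reaches_gate; apply: Or41.
  by exists (IpsX _ i).
by exists (IpsZ _ i).
Qed.

(** The output is exposed by the empty path, so its sign bit is proved to be 0 although its bits
    represent [-1]; the refutation [B] turns this into a nonzero integer. *)
Lemma cps_refutation_to_ips (C : circuit ('I_n + 'I_m)) (t : nat)
    (B : circuit (ips_var t 1)) :
  conic C -> cpoly (ccomp C H) = -1 -> clen (ccomp C H) = t ->
  ips_refutation (fun _ => bvp t 1) B ->
  exists D : circuit (ips_var n m), ips_refutation (fun j => tr (H j)) D /\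
    (csize D <= csize (ccomp C H) * (11 + 4 * 5000 * t.+1 ^ 2) + (10 + csize B))%N.
Proof.
move=> conicC val_C len_C [M M0 BM].
have /andP[ord_G lt_out] := circuitP (ccomp C H).
set l := nodes (ccomp C H) in ord_G lt_out; set o := out (ccomp C H) in lt_out.
have good_gate k : (k < size l)%N -> exposed_node C H k ->
    positive_gate l (exposed_node C H) k \/
    exists v, (ev1 v, ev2 v) = (0, last 0 (node_bits l k)).
  move=> _ /(exposed_gate conicC)[pk|[j uj ->]]; [by left | right].
  (* The placeholder of axiom [j] is worth 0 at [ev1] and [tr (H j)] at [ev2], the sign bit at the
     output of the copy of [H j]. *)
  exists (IpsY _ j); rewrite /ev1 /ev2 /= tr_last; congr (0, last 0 _).
  by rewrite /node_bits node_val_place_out.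
have [s1 [_ prog_s1 sz_s1 ok_s1]] :=
  reaches_nodes t ord_G reaches_boolean_var good_gate (fun x h => h) (program_nil _ _).
(* The output has length exactly [t], so it is among the nodes treated. *)
have [rep_o pos_o] : node_ok l (exposed_node C H) s1 o.
  by apply: ok_s1 => //; rewrite -len_C.
have {}pos_o := pos_o (exposed_out C H).
have sz_o : size (node_bits l o) = t by rewrite size_node_bits.
have poly_o : node_poly l o = -1 by [].
rewrite poly_o in rep_o.
have [s2 [_ prog_s2 sz_s2 M_s2]] :=
  reaches_bvp BM sz_o rep_o pos_o (fun x h => h) prog_s1.
have [D [sz_D D1 D2]] := program_circuit prog_s2 M_s2.
exists D; split; first by exists M.
by rewrite sz_D (leq_trans sz_s2) // leq_add2r.
Qed.

End Main.

Theorem theorem6p14 :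
  (exists q0 : {mpoly int[2]}, forall t M : nat, (0 < t)%N -> (0 < M)%N ->
     exists C : circuit (ips_var t 1),
       ips_refutation (fun _ => bvp t M%:Z) C /\
       (csize C)%:Z <= eval2 q0 t (tau M%:Z)) ->
  exists q : {mpoly int[2]},
    forall (n m : nat) (F : seq {mpoly int[n]}) (H : 'I_m -> circuit 'I_n)
           (C : circuit ('I_n + 'I_m)) (s t : nat),
      cps_refutation F H C ->
      csize (ccomp C H) = s -> clen (ccomp C H) = t ->
      exists D : circuit (ips_var n m),
        ips_refutation (fun j => tr (H j)) D /\ (csize D)%:Z <= eval2 q s t.
Proof.
case=> q0 q0P.
pose X : {mpoly int[2]} := 'X_0; pose Y : {mpoly int[2]} := 'X_1.
pose c : nat := (4 * 5000)%N.
(* [X] stands for [s] and [Y] for [t]. The first summand bounds the refutation for [M = 1], where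
   [tau 1] is a fixed number; the second bounds the simulation and the passage to it. *)
exists (comp_mpoly [tuple Y; (tau 1)%:Z%:MP] q0 +
        (X * (11%:Z%:MP + c%:Z%:MP * (Y + 1) ^+ 2) + 10%:Z%:MP)).
move=> n m F H C s t [_ conicC val_C] sz_C len_C.
have t0 : (0 < t)%N.
  by rewrite -len_C; have /andP[ord_G lt_out] := circuitP (ccomp C H); apply: node_len_gt0.
have [B [refB sz_B]] := q0P t 1%N t0 isT.
have [D [refD sz_D]] := cps_refutation_to_ips conicC val_C len_C refB.
exists D; split=> //; rewrite sz_C in sz_D.
have -> : eval2 (comp_mpoly [tuple Y; (tau 1)%:Z%:MP] q0 +
    (X * (11%:Z%:MP + c%:Z%:MP * (Y + 1) ^+ 2) + 10%:Z%:MP)) s t =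
    eval2 q0 t (tau 1) + (s%:Z * (11 + c%:Z * (t%:Z + 1) ^+ 2) + 10).
  rewrite /eval2 mevalD comp_mpoly_meval; congr (_ + _).
    by apply: meval_eq => i; case: i => [[|[|]]] //= lt_i;
      rewrite !(tnth_nth 0) /= ?mevalXU ?mevalC ?(tnth_nth 0).
  by rewrite !(mevalD, mevalM, rmorphXn) /= !mevalC !mevalXU !(tnth_nth 0).
rewrite (le_trans _ (lerD sz_B (lexx _))) //.
have -> : s%:Z * (11 + c%:Z * (t%:Z + 1) ^+ 2) + 10 =
    (s * (11 + 4 * 5000 * t.+1 ^ 2) + 10)%N%:Z.
  by rewrite -[t.+1]addn1 -mulnn !(PoszD, PoszM) /c expr2.
by rewrite -PoszD lez_nat addnC -addnA.
Qed.
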